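(* For integers $n\ge1$, the proportion of permutations $\sigma\in S_n$ such that every positive integer below $n$ can be expressed as a sum of lengths of distinct cycles of $\sigma$ equals $$\frac{C}{n}\left(1+O\left(\frac1n\right)\right),$$ where $C=(1-e^{-\gamma})^{-1}=2.280291\ldots$ and $\gamma$ is Euler's constant.
   Context: $S_n$ is the symmetric group on $\{1,\dots,n\}$; cycles in the disjoint cycle decomposition include fixed points (cycles of length 1). *)

(* Defs.v *)
From HB Require Import structures.
From mathcomp Require Import all_boot all_order all_algebra all_fingroup.
From mathcomp Require Import all_classical all_reals all_analysis.

Set Implicit Arguments.
Unset Strict Implicit.
Unset Printing Implicit Defensive.

Import Order.TTheory GRing.Theory Num.Theory.
Import numFieldNormedType.Exports.

Local Open Scope ring_scope.
Local Open Scope classical_set_scope.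

(* A cycle of s is represented by its support, an element of [porbits s]; fixed
   points give singleton orbits.  A is thus a set of distinct cycles of s. *)
Definition sum_of_cycle_lengths (n : nat) (s : 'S_n) (m : nat) : bool :=
  [exists A : {set {set 'I_n}},
    (A \subset porbits s) && (m == \sum_(c in A) #|c|)%N].

Definition all_below_sum_of_cycle_lengths (n : nat) (s : 'S_n) : bool :=
  [forall m : 'I_n, (0 < m)%N ==> sum_of_cycle_lengths s m].

Definition proportion_all_below (R : realType) (n : nat) : R :=
  #|[set s : 'S_n | all_below_sum_of_cycle_lengths s]%SET|%:R / #|{: 'S_n}|%:R.

(* [series harmonic n] is 1 + 1/2 + ... + 1/n. *)
Definition euler_gamma (R : realType) : R :=
  lim ((fun n : nat => series (@harmonic R) n - ln n%:R) @ \oo).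

Definition cycle_constant (R : realType) : R :=
  (1 - expR (- euler_gamma R))^-1.

(* Main.v *)
(* Call a set of cycles practical if every integer up to its total length is a
   sum of lengths of distinct cycles in it.  Every permutation of [n] points has
   a largest practical set of cycles, and if this set covers [j] points, then
   the other cycles are longer than [j + 1].  With [P j] the proportion of
   practical permutations and [q (n, k)] that of permutations all of whose cycles
   are longer than [k], this gives the renewal equation
     sum_(1 <= k <= N) P (k - 1) q (N - k, k) = 1.
   As [n] grows, [q (n, k)] tends to [exp (- H_k)], and [k exp (- H_k)] is
   [exp (- gamma) + O (1 / k)].  Subtract from the equation for [N] the mean of
   the equations for smaller indices, up to [K] about [N / 2]: the sequence
   [C / k] in place of [P (k - 1)] satisfies the result up to [O (1 / N ^ 2)], so
   the error [P (N - 1) - C / N] is a contraction of the earlier errors plus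
   [O (1 / N ^ 2)].  The contraction constant is the limit of
   [sum_k (N / k) ^ 2 |q (N / 2, k) - q (N - k, k)|]; it is shown to be below 1
   by a rigorous numerical solution of the delay equation behind Buchstab's
   function. *)
Require Import Defs.
From Stdlib Require Import NArith FMapPositive.
From mathcomp Require Import all_boot all_order all_algebra all_fingroup.
From mathcomp Require Import zify.

Set Implicit Arguments.
Unset Strict Implicit.
Unset Printing Implicit Defensive.

Import Order.TTheory GRing.Theory Num.Theory.

(** * Counting permutations by cycle statistics *)

Local Open Scope nat_scope.

(** The renewal equation alone gives no contraction: for small [k] its kernel [q (N - k, k)] is
    close to [exp (- gamma) / k], which the weight [(N / k) ^ 2] blows up. The mean removes this
    common part, because [q (K, k)] and [q (N - k, k)] have the same limit in their first argument.
    It is also explicit: the recursion [K q (K, k) = sum_(i < K - k) q (i, k)] says that the mean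
    over the indices [j < K] of the kernels [q (j - k, k)], taken as 0 when [j < k], is [q (K, k)]
    itself. The index [j = 0] has left-hand side 0 instead of 1, so the difference of equations has
    right-hand side [1 / K]. With [1 / k] in place of [P (k - 1)] its left-hand side is
    [(1 - exp (- gamma)) / K + O (1 / N ^ 2)], by Buchstab's identity; matching the two forces
    [C (1 - exp (- gamma)) = 1]. For [K = uphalf N] both kernels vanish when [K <= k < N], so only
    errors of index below [K] enter. The weight [(N / k) ^ 2] arises from the bound [M / k ^ 2] that
    the induction carries. *)

Definition orbits_in (T : finType) (U : {set T}) (s : {perm T}) : {set {set T}} :=
  [set porbit s x | x in U].

Definition stable (T : finType) (U : {set T}) (s : {perm T}) : bool :=
  [forall x in U, s x \in U].

(** Quantified over all finite types, so that one statistic applies both to the cycles inside a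
    subset [U] and, after relabelling, to those of a permutation of ['I_#|U|]. *)
Definition statistic := forall T : finType, {set {set T}} -> bool.

Definition relabel_invariant (phi : statistic) :=
  forall (T T' : finType) (f : T -> T') (A : {set {set T}}), injective f ->
    phi T' [set f @: (c : {set T}) | c in A] = phi T A.

Definition count_on (phi : statistic) (T : finType) (U : {set T}) : nat :=
  #|[set s : {perm T} | perm_on U s && phi T (orbits_in U s)]|.

Definition count (phi : statistic) (n : nat) : nat := count_on phi [set: 'I_n].

Lemma orbits_inT (T : finType) (s : {perm T}) : orbits_in [set: T] s = porbits s.
Proof. by apply/setP => c; apply/imsetP/imsetP => -[x _ ->]; exists x. Qed.

Lemma countE (phi : statistic) n : count phi n = #|[set s : 'S_n | phi _ (porbits s)]|.
Proof.
rewrite /count /count_on; apply: eq_card => s; rewrite !inE orbits_inT.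
have -> // : perm_on [set: 'I_n] s.
by apply/subsetP => x; rewrite inE.
Qed.

(** * Transport of permutations along injections *)

Section Relabel.

Variables (T T' : finType) (f : T -> T').
Hypothesis f_inj : injective f.

Definition lift_fun (s : {perm T}) (y : T') : T' :=
  if [pick x | f x == y] is Some x then f (s x) else y.

Lemma lift_fun_in s x : lift_fun s (f x) = f (s x).
Proof.
rewrite /lift_fun; case: pickP => [z /eqP /f_inj -> //|/(_ x)].
by rewrite eqxx.
Qed.

Lemma lift_fun_out s y : (forall x, f x != y) -> lift_fun s y = y.
Proof. by move=> H; rewrite /lift_fun; case: pickP => // x; rewrite (negPf (H x)). Qed.

Lemma lift_fun_inj s : injective (lift_fun s).
Proof.
move=> y z; have [/existsP[x /eqP <-]|/existsPn Hy] := boolP [exists x, f x == y].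
  have [/existsP[x' /eqP <-]|/existsPn Hz] := boolP [exists x, f x == z].
    by rewrite !lift_fun_in => /f_inj /perm_inj ->.
  by rewrite lift_fun_in (lift_fun_out _ Hz) => E; have := Hz (s x); rewrite E eqxx.
have [/existsP[x' /eqP <-]|/existsPn Hz] := boolP [exists x, f x == z].
  by rewrite lift_fun_in (lift_fun_out _ Hy) => E; have := Hy (s x'); rewrite E eqxx.
by rewrite !lift_fun_out.
Qed.

Definition relabel (s : {perm T}) : {perm T'} := perm (@lift_fun_inj s).

Lemma relabelE s x : relabel s (f x) = f (s x).
Proof. by rewrite permE lift_fun_in. Qed.

Lemma relabel_inj : injective relabel.
Proof.
move=> s t E; apply/permP => x; apply: f_inj.
by rewrite -!relabelE E.
Qed.

Lemma relabel_on s : perm_on (f @: [set: T]) (relabel s).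
Proof.
apply/subsetP => y; rewrite inE; apply: contraR => yf; rewrite permE lift_fun_out//.
by move=> x; apply: contra yf => /eqP <-; rewrite imset_f ?inE.
Qed.

Lemma porbit_relabel s x : porbit (relabel s) (f x) = f @: porbit s x.
Proof.
have iterE i : (relabel s ^+ i)%g (f x) = f ((s ^+ i)%g x).
  by elim: i => [|i IH]; rewrite ?expg0 ?perm1// !expgSr !permM IH relabelE.
apply/setP => y; apply/porbitP/imsetP => [[i ->]|[z /porbitP[i ->] ->]].
  by exists ((s ^+ i)%g x); rewrite ?mem_porbit// iterE.
by exists i; rewrite iterE.
Qed.

Lemma orbits_in_relabel s :
  orbits_in (f @: [set: T]) (relabel s) = [set f @: (c : {set T}) | c in porbits s].
Proof.
apply/setP => c; apply/imsetP/imsetP => [[y /imsetP[x _ ->] ->]|[d /imsetP[x _ ->] ->]].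
  by exists (porbit s x); rewrite ?porbit_relabel ?imset_f.
by exists (f x); rewrite ?porbit_relabel ?imset_f ?inE.
Qed.

(** By cardinality: [relabel] is injective, and there are as many permutations supported on the
    image of [f] as permutations of [T]. *)
Lemma relabel_onto (t : {perm T'}) : perm_on (f @: [set: T]) t ->
  exists s, t = relabel s.
Proof.
move=> tV; have : t \in relabel @: [set: {perm T}].
  suff -> : relabel @: [set: {perm T}] = [set t | perm_on (f @: [set: T]) t] by rewrite inE.
  apply/eqP; rewrite eqEcard; apply/andP; split.
    by apply/subsetP => u /imsetP[s _ ->]; rewrite inE relabel_on.
  rewrite card_imset; last exact: relabel_inj.
  rewrite cardsE card_perm card_imset// cardsT.
  have -> : #|[set: {perm T}]| = #|perm_on [set: T]|.
    by apply: eq_card => s; rewrite inE; apply/esym/subsetP => x; rewrite inE.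
  by rewrite card_perm cardsT.
by case/imsetP => s _ ->; exists s.
Qed.

Lemma count_on_relabel (phi : statistic) : relabel_invariant phi ->
  count_on phi (f @: [set: T]) = #|[set s : {perm T} | phi T (porbits s)]|.
Proof.
move=> inv; rewrite -(card_imset _ relabel_inj); apply: eq_card => t.
rewrite inE; apply/andP/imsetP => [[tV]|[s]].
  have [s ->] := relabel_onto tV; rewrite orbits_in_relabel inv// => H.
  by exists s; rewrite ?inE.
by rewrite inE => H ->; rewrite relabel_on orbits_in_relabel inv.
Qed.

End Relabel.

Lemma count_onE (phi : statistic) (T : finType) (U : {set T}) :
  relabel_invariant phi -> count_on phi U = count phi #|U|.
Proof.
move=> inv; rewrite countE -(count_on_relabel (f := @enum_val _ (mem U)))//; last exact: enum_val_inj.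
congr (count_on _ _); apply/setP => x; apply/idP/imsetP => [xU|[i _ ->]]; last exact: enum_valP.
by exists (enum_rank_in xU x); rewrite ?inE// enum_rankK_in.
Qed.

(** * Permutations preserving a subset *)

Section Split.

Variable T : finType.
Implicit Types (U : {set T}) (s : {perm T}).

Lemma stable_astabs U (s : {perm T}) : stable U s -> s \in 'N(U | 'P)%g.
Proof.
move=> /forall_inP H; rewrite !inE /=; apply/subsetP => x xU.
by rewrite inE /= apermE; exact: H.
Qed.

Lemma stableE U (s : {perm T}) x : stable U s -> (s x \in U) = (x \in U).
Proof. by move=> /stable_astabs /astabsP; exact. Qed.

Lemma stableC U (s : {perm T}) : stable U s -> stable (~: U) s.
Proof. by move=> H; apply/forall_inP => x; rewrite !inE stableE. Qed.

Lemma perm_on_stable U (s : {perm T}) : perm_on U s -> stable U s.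
Proof. by move=> H; apply/forall_inP => x; rewrite perm_closed. Qed.

Lemma eq_orbits_in U (s t : {perm T}) : stable U s -> {in U, s =1 t} ->
  orbits_in U s = orbits_in U t.
Proof.
move=> sU st; apply: eq_in_imset => x xU.
have E i : (s ^+ i)%g x = (t ^+ i)%g x /\ (s ^+ i)%g x \in U.
  elim: i => [|i [IH1 IH2]]; first by rewrite !expg0 perm1.
  by rewrite !expgSr !permM -IH1 -st// stableE.
by apply/setP => y; apply/porbitP/porbitP => -[i ->]; exists i; case: (E i).
Qed.

(** A permutation preserving [U] is uniquely the product of one supported on [U] and one supported
    on the complement, namely its two restrictions, and its cycles split accordingly. *)
Lemma card_stable_split U (phi psi : statistic) :
  #|[set s : {perm T} | [&& stable U s, phi T (orbits_in U s) &
     psi T (orbits_in (~: U) s)]]| = count_on phi U * count_on psi (~: U).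
Proof.
have dis (a b : {perm T}) x : perm_on U a -> perm_on (~: U) b ->
    (a * b)%g x = if x \in U then a x else b x.
  move=> aU bU; rewrite permM; case: ifP => xU.
    by rewrite (out_perm bU)// inE perm_closed// xU.
  by rewrite (out_perm aU)// xU.
rewrite /count_on -cardsX.
pose g (ab : {perm T} * {perm T}) := (ab.1 * ab.2)%g.
rewrite -(@card_in_imset _ _ g); last first.
  move=> [a b] [c d]; rewrite !inE /g /= => /andP[/andP[aU _] /andP[bU _]].
  move=> /andP[/andP[cU _] /andP[dU _]] /permP E.
  congr (_, _); apply/permP => x; have := E x; rewrite !dis//.
    by case: ifP => // xU _; rewrite (out_perm aU) ?(out_perm cU) ?xU.
  by case: ifP => // xU _; rewrite (out_perm bU) ?(out_perm dU) ?inE ?xU.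
apply: eq_card => s; rewrite inE; apply/and3P/imsetP => [[sU sphi spsi]|[[a b]]].
  have sN := stable_astabs sU; have sNC := stable_astabs (stableC sU).
  exists (restr_perm U s, restr_perm (~: U) s); last first.
    apply/permP => x; rewrite dis ?restr_perm_on//.
    case: ifP => xU /=; first by rewrite (restr_permE sN xU).
    by rewrite (restr_permE sNC)// inE xU.
  rewrite !inE /= !restr_perm_on /=.
  rewrite -(eq_orbits_in sU) => [|x xU]; last by rewrite restr_permE.
  rewrite sphi /= -(eq_orbits_in (stableC sU)) => [|x xU]; last by rewrite restr_permE.
  by [].
rewrite !inE /= => /andP[/andP[aU aphi] /andP[bU bpsi]] ->; rewrite /g /=.
have abU : stable U (a * b).
  by apply/forall_inP => x xU; rewrite dis// xU perm_closed.
split => //.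
  rewrite -(eq_orbits_in (perm_on_stable aU))// => x xU.
  by rewrite dis// xU.
rewrite -(eq_orbits_in (perm_on_stable bU))// => x xU.
by rewrite dis// ifN//; rewrite inE in xU.
Qed.

End Split.

Lemma sum_by_card (T : finType) (F : nat -> nat) :
  \sum_(U : {set T}) F #|U| = \sum_(j < #|T|.+1) 'C(#|T|, j) * F j.
Proof.
rewrite (partition_big (fun U : {set T} => inord #|U| : 'I_(#|T|.+1)) predT)//=.
apply: eq_bigr => j _.
have E (U : {set T}) : (inord #|U| == j) = (#|U| == j).
  by rewrite -val_eqE /= inordK// ltnS max_card.
rewrite (eq_bigl _ _ E) (eq_bigr (fun=> F j)) => [|U /eqP -> //].
by rewrite sum_nat_const -card_draws cardsE.
Qed.

(** * Practical sets of cycles and the core *)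

Definition csize (T : finType) (A : {set {set T}}) := \sum_(c in A) #|c|.

Definition reachable (T : finType) (A : {set {set T}}) (m : nat) : bool :=
  [exists B : {set {set T}}, (B \subset A) && (m == csize B)].

Definition practical : statistic := fun T A =>
  [forall m : 'I_(csize A), reachable A m].

Definition rough k : statistic := fun T A => [forall c in A, k < #|c|].

Definition single k : statistic := fun T A => (#|A| == 1) && rough k A.

Lemma practicalP (T : finType) (A : {set {set T}}) :
  reflect (forall m, m <= csize A -> exists2 B : {set {set T}}, B \subset A & csize B = m)
    (practical A).
Proof.
apply: (iffP forallP) => [H m|H m]; last first.
  have [B BA BE] := H m (ltnW (ltn_ord m)).
  by apply/existsP; exists B; rewrite BA BE eqxx.
rewrite leq_eqVlt => /orP[/eqP ->|mA]; first by exists A.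
have /existsP[B /andP[BA /eqP BE]] := H (Ordinal mA).
by exists B.
Qed.

Lemma csize_sub (T : finType) (A B : {set {set T}}) : A \subset B -> csize A <= csize B.
Proof. by move=> AB; rewrite /csize [leqRHS](big_setID A) /= (setIidPr AB) leq_addr. Qed.

Lemma leq_csize (T : finType) (A : {set {set T}}) c : c \in A -> #|c| <= csize A.
Proof. by move=> cA; rewrite /csize (bigD1 c)//= leq_addr. Qed.

Section Imset.

Variables (T T' : finType) (f : T -> T').
Hypothesis f_inj : injective f.

Let F (c : {set T}) : {set T'} := f @: c.

Let F_inj : injective F.
Proof. exact: imset_inj. Qed.

Lemma csize_imset (A : {set {set T}}) : csize (F @: A) = csize A.
Proof.
rewrite /csize big_imset /=; last by move=> x y _ _; exact: F_inj.
by apply: eq_bigr => c _; rewrite card_imset.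
Qed.

Lemma practical_imset (A : {set {set T}}) : practical (F @: A) = practical A.
Proof.
apply/practicalP/practicalP; rewrite csize_imset => H m mA.
  have [B BA <-] := H m mA; exists (F @^-1: B).
    apply/subsetP => c; rewrite inE => cB; have := subsetP BA _ cB.
    by case/imsetP => d dA /F_inj ->.
  rewrite -csize_imset; congr csize; apply/setP => c; apply/imsetP/idP => [[d]|cB].
    by rewrite inE => dB ->.
  by have /imsetP[d dA E] := subsetP BA _ cB; exists d; rewrite // inE -E.
have [B BA <-] := H m mA; exists (F @: B); first exact: imsetS.
exact: csize_imset.
Qed.

Lemma rough_imset k (A : {set {set T}}) : rough k (F @: A) = rough k A.
Proof.
apply/forall_inP/forall_inP => H c cA.
  by rewrite -(card_imset _ f_inj); apply: H; apply: imset_f.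
by case/imsetP: cA => d dA ->; rewrite card_imset//; exact: H.
Qed.

Lemma single_imset k (A : {set {set T}}) : single k (F @: A) = single k A.
Proof. by rewrite /single rough_imset card_imset. Qed.

End Imset.

Lemma practical_relabel : relabel_invariant practical.
Proof. by move=> T T' f A finj; exact: practical_imset. Qed.

Lemma rough_relabel k : relabel_invariant (rough k).
Proof. by move=> T T' f A finj; exact: rough_imset. Qed.

Lemma single_relabel k : relabel_invariant (single k).
Proof. by move=> T T' f A finj; exact: single_imset. Qed.

Lemma csize_setU1 (T : finType) (A : {set {set T}}) c : c \notin A ->
  csize (c |: A) = #|c| + csize A.
Proof. by move=> cA; rewrite /csize big_setU1. Qed.

Lemma practical0 (T : finType) : practical (set0 : {set {set T}}).
Proof.
apply/practicalP => m; rewrite /csize big_set0 leqn0 => /eqP ->.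
by exists set0; rewrite ?sub0set// /csize big_set0.
Qed.

(** A value above [csize A] uses [c] together with a subset of [A] summing to the rest; the bound on
    [#|c|] makes this rest nonnegative. *)
Lemma practical_setU1 (T : finType) (A : {set {set T}}) c : c \notin A ->
  practical A -> #|c| <= (csize A).+1 -> practical (c |: A).
Proof.
move=> cA /practicalP pA cs; apply/practicalP => m; rewrite csize_setU1// => mA.
have [small|large] := leqP m (csize A).
  by have [B BA BE] := pA m small; exists B => //; exact: subset_trans BA (subsetUr _ _).
have [|B BA BE] := pA (m - #|c|); first by lia.
exists (c |: B); first exact: setUS.
rewrite csize_setU1 ?BE; first by lia.
by apply: contra cA; exact: (subsetP BA).
Qed.

Definition core (T : finType) (O A : {set {set T}}) : bool :=
  [&& A \subset O, practical A & rough (csize A).+1 (O :\: A)].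

(** A practical subset of maximal total length works: by [practical_setU1], an outside cycle of
    length at most [csize A + 1] could still be added. *)
Lemma core_exists (T : finType) (O : {set {set T}}) :
  (forall c, c \in O -> 0 < #|c|) -> exists A, core O A.
Proof.
move=> O0.
have H0 : (set0 \subset O) && practical (set0 : {set {set T}}) by rewrite sub0set practical0.
have [A /andP[AO pA] Amax] := @arg_maxnP _ set0
  (fun A : {set {set T}} => (A \subset O) && practical A) (@csize T) H0.
exists A; rewrite /core AO pA /=; apply/forall_inP => c; rewrite inE => /andP[cA cO].
rewrite ltnNge; apply/negP => cs.
have := Amax (c |: A); rewrite practical_setU1// subUset sub1set cO AO => /(_ isT).
by rewrite /= csize_setU1//; have := O0 c cO; lia.
Qed.

(* Least cycle of [B] outside [A]: it would exceed [csize A + 1], yet by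
   practicality of [B] its length minus one is a sum of shorter cycles of [B],
   all of them in [A]. *)
Lemma core_sub (T : finType) (O A B : {set {set T}}) : core O A -> core O B -> B \subset A.
Proof.
move=> /and3P[AO pA /forall_inP rA] /and3P[BO /practicalP pB _].
apply/negPn/negP => /subsetPn[c0 c0B c0A].
have H0 : c0 \in B :\: A by rewrite inE c0A.
have [c] := @arg_minnP _ c0 (mem (B :\: A)) (fun c : {set T} => #|c|) H0.
rewrite /= inE => /andP[cA cB] cmin.
have cO : c \in O := subsetP BO _ cB.
have big : (csize A).+1 < #|c| by apply: rA; rewrite inE cA.
have c_gt0 : 0 < #|c| := leq_ltn_trans (leq0n _) big.
have [|D DB DE] := pB #|c|.-1; first exact: leq_trans (leq_pred _) (leq_csize cB).
have DA : D \subset A.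
  apply/subsetP => d dD; apply/negPn/negP => dA.
  have := cmin d; rewrite /= inE dA (subsetP DB)// => /(_ isT) /leq_trans.
  by move=> /(_ _ (leq_csize dD)); rewrite DE leqNgt ltn_predL c_gt0.
by have := csize_sub DA; rewrite DE -ltnS prednK// leqNgt big.
Qed.

Lemma core_unique (T : finType) (O A B : {set {set T}}) : core O A -> core O B -> A = B.
Proof. by move=> cA cB; apply/eqP; rewrite eqEsubset (core_sub cA cB) (core_sub cB cA). Qed.

(** * Double counting over invariant sets of points *)

Section PermCount.

Variable T : finType.
Implicit Types (U : {set T}) (s : {perm T}) (A : {set {set T}}).

Lemma porbits_trivIset s : trivIset (porbits s).
Proof.
apply/trivIsetP => _ _ /imsetP[x _ ->] /imsetP[y _ ->]; apply: contraR.
move=> /pred0Pn[z /andP[/= zx zy]].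
by move: zx zy; rewrite -!eq_porbit_mem => /eqP <- /eqP <-.
Qed.

Lemma orbits_in_sub U s : orbits_in U s \subset porbits s.
Proof. by apply/subsetP => _ /imsetP[x _ ->]; apply: imset_f. Qed.

Lemma porbit_sub_stable U s x : stable U s -> x \in U -> porbit s x \subset U.
Proof.
move=> sU xU; apply/subsetP => y /porbitP[i ->].
by elim: i => [|i IH]; rewrite ?expg0 ?perm1// expgSr permM stableE.
Qed.

Lemma cover_orbits_in U s : stable U s -> cover (orbits_in U s) = U.
Proof.
move=> sU; apply/setP => x; apply/bigcupP/idP => [[_ /imsetP[y yU ->]]|xU].
  by move=> xy; exact: (subsetP (porbit_sub_stable sU yU)).
by exists (porbit s x); rewrite ?porbit_id// imset_f.
Qed.

Lemma csize_cover s A : A \subset porbits s -> csize A = #|cover A|.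
Proof. by move=> sA; apply/eqP; exact: trivIsetS sA (porbits_trivIset s). Qed.

Lemma csize_orbits_in U s : stable U s -> csize (orbits_in U s) = #|U|.
Proof. by move=> sU; rewrite (csize_cover (orbits_in_sub U s)) cover_orbits_in. Qed.

Lemma orbits_inD U s : stable U s -> porbits s :\: orbits_in U s = orbits_in (~: U) s.
Proof.
move=> sU; apply/setP => c; rewrite inE; apply/andP/imsetP => [[cU /imsetP[x _ E]]|[x xU ->]].
  by exists x => //; rewrite inE; apply: contra cU => xU; rewrite E imset_f.
split; last exact: imset_f.
apply/negP => /imsetP[y yU E]; have : x \in porbit s y by rewrite -E porbit_id.
by move=> /(subsetP (porbit_sub_stable sU yU)) xU'; rewrite inE xU' in xU.
Qed.

Lemma cover_stable s A : A \subset porbits s -> stable (cover A) s.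
Proof.
move=> sA; apply/forall_inP => x /bigcupP[c cA xc]; apply/bigcupP; exists c => //.
have /imsetP[y _ E] := subsetP sA _ cA; move: xc; rewrite E => /porbitP[i ->].
by rewrite -permM -expgSr mem_porbit.
Qed.

Lemma orbits_in_cover s A : A \subset porbits s -> orbits_in (cover A) s = A.
Proof.
move=> sA; have H c x : c \in A -> x \in c -> porbit s x = c.
  move=> cA xc; have /imsetP[y _ E] := subsetP sA _ cA.
  by rewrite E; apply/eqP; rewrite eq_porbit_mem -E.
apply/setP => c; apply/imsetP/idP => [[x /bigcupP[d dA xd] ->]|cA].
  by rewrite (H d).
have /imsetP[y _ E] := subsetP sA _ cA.
have yc : y \in c by rewrite E porbit_id.
by exists y; [apply/bigcupP; exists c|rewrite (H c)].
Qed.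

(** The core is encoded here by the set [U] of points that it covers, the form in which
    [card_stable_split] applies. *)
Lemma card_core s : #|[set U : {set T} | [&& stable U s, practical (orbits_in U s) &
  rough #|U|.+1 (orbits_in (~: U) s)]]| = 1.
Proof.
have [|A cA] := @core_exists _ (porbits s).
  by move=> _ /imsetP[x _ ->]; rewrite lt0n card_porbit_neq0.
rewrite -(cards1 (cover A)); apply: eq_card => U; rewrite !inE.
have /and3P[sA pA rA] := cA.
apply/and3P/eqP => [[sU pU rU]|->].
  rewrite (@core_unique _ (porbits s) A (orbits_in U s)) ?cover_orbits_in//.
  by rewrite /core orbits_in_sub pU csize_orbits_in// orbits_inD.
rewrite cover_stable// orbits_in_cover// -orbits_inD ?cover_stable//.
by rewrite orbits_in_cover// -(csize_cover sA).
Qed.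

(** Counts the pairs of a permutation and the point set of its core: one pair for each permutation,
    and a product of two counts for each [U]. *)
Lemma renewal_count_on :
  #|T|`! = \sum_(U : {set T}) count practical #|U| * count (rough #|U|.+1) (#|T| - #|U|).
Proof.
transitivity (\sum_(s : {perm T}) 1).
  rewrite sum1_card -cardsT -(card_perm [set: T]); apply: eq_card => s.
  by transitivity true => //; apply/subsetP => x; rewrite inE.
rewrite (eq_bigr (fun s => \sum_(U : {set T} | [&& stable U s, practical (orbits_in U s) &
  rough #|U|.+1 (orbits_in (~: U) s)]) 1)); last first.
  by move=> s _; rewrite sum1dep_card card_core.
rewrite (exchange_big_dep predT)//=; apply: eq_bigr => U _.
rewrite sum1dep_card (card_stable_split U practical (rough #|U|.+1)).
rewrite (count_onE _ practical_relabel) (count_onE _ (@rough_relabel _)).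
by rewrite [#|~: U|]cardsCs setCK.
Qed.

(** Puts a permutation with a marked cycle [U] into the product form required by
    [card_stable_split]. *)
Lemma mem_porbits_stable k U s : (U \in porbits s) && rough k (porbits s) =
  [&& stable U s, single k (orbits_in U s) & rough k (orbits_in (~: U) s)].
Proof.
apply/andP/and3P => [[Us /forall_inP rs]|[sU /andP[/cards1P[c cE] /forall_inP r1] /forall_inP r2]].
  have s1 : [set U] \subset porbits s by rewrite sub1set.
  have cU : cover [set U] = U by rewrite /cover big_set1.
  have sU : stable U s by rewrite -cU; exact: cover_stable.
  have oU : orbits_in U s = [set U] by rewrite -{1}cU orbits_in_cover.
  split => //; first rewrite /single oU cards1 eqxx /=.
    by apply/forall_inP => c; rewrite inE => /eqP ->; exact: rs.
  by rewrite -orbits_inD//; apply/forall_inP => c; rewrite inE => /andP[_]; exact: rs.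
have UE : U = c by rewrite -(cover_orbits_in sU) cE /cover big_set1.
have UO : U \in orbits_in U s by rewrite cE UE inE.
split; first exact: (subsetP (orbits_in_sub U s)).
apply/forall_inP => d ds; have [dU|dU] := boolP (d \in orbits_in U s); first exact: r1.
by apply: r2; rewrite -orbits_inD// inE dU.
Qed.

(** Counts pairs of a [rough] permutation and one of its cycles, weighted by the length of the
    cycle: the lengths in one permutation add up to [#|T|]. *)
Lemma rough_count_on k : #|T| * count (rough k) #|T| =
  \sum_(U : {set T}) #|U| * (count (single k) #|U| * count (rough k) (#|T| - #|U|)).
Proof.
have -> : count (rough k) #|T| = #|[set s : {perm T} | rough k (porbits s)]|.
  rewrite -[in LHS]cardsT -(count_onE _ (@rough_relabel k)) /count_on.
  apply: eq_card => s; rewrite !inE orbits_inT.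
  by have -> : perm_on [set: T] s by apply/subsetP => x; rewrite inE.
rewrite mulnC -sum_nat_const.
rewrite (eq_bigr (fun s => \sum_(U in porbits s) #|U|)); last first.
  move=> s _; rewrite -/(csize (porbits s)) -orbits_inT csize_orbits_in ?cardsT//.
  by apply/forall_inP => x; rewrite inE.
rewrite (exchange_big_dep predT)//=; apply: eq_bigr => U _.
rewrite sum_nat_const mulnC; congr (_ * _).
rewrite -(count_onE U (@single_relabel k)).
have -> : #|T| - #|U| = #|~: U| by rewrite [RHS]cardsCs setCK.
rewrite -(count_onE _ (@rough_relabel k)) -card_stable_split.
by apply: eq_card => s; rewrite inE -mem_porbits_stable unfold_in /= inE andbC.
Qed.

End PermCount.

Lemma renewal_count n :
  n`! = \sum_(j < n.+1) 'C(n, j) * (count practical j * count (rough j.+1) (n - j)).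
Proof.
have := renewal_count_on 'I_n; rewrite card_ord => ->.
by rewrite (sum_by_card _ (fun j => count practical j * count (rough j.+1) (n - j))) card_ord.
Qed.

Lemma rough_count n k : n * count (rough k) n =
  \sum_(j < n.+1) 'C(n, j) * (j * (count (single k) j * count (rough k) (n - j))).
Proof.
have := rough_count_on 'I_n k; rewrite card_ord => ->.
by rewrite (sum_by_card _ (fun j => j * (count (single k) j * count (rough k) (n - j)))) card_ord.
Qed.

Lemma count_rough0 n : count (rough 0) n = n`!.
Proof.
rewrite countE -[in RHS](card_ord n) -[in RHS]cardsT -card_perm; apply: eq_card => s.
rewrite inE; have -> : rough 0 (porbits s).
  by apply/forall_inP => _ /imsetP[x _ ->]; rewrite lt0n card_porbit_neq0.
by apply/esym/subsetP => x; rewrite inE.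
Qed.

Lemma count_single k n : count (single k) n = (k < n) * count (single 0) n.
Proof.
rewrite !countE; have E (s : 'S_n) : single k (porbits s) = (k < n) && single 0 (porbits s).
  rewrite /single; case: (boolP (#|porbits s| == 1)) => [/cards1P[c cE]|]; last by rewrite andbF.
  have cn : #|c| = n.
    have := csize_orbits_in (U := [set: 'I_n]) (s := s).
    rewrite orbits_inT cE /csize big_set1 cardsT card_ord; apply.
    by apply/forall_inP => x; rewrite inE.
  have r j : rough j [set c] = (j < n).
    by apply/forall_inP/idP => [|jn d]; [move=> /(_ c); rewrite inE eqxx cn; apply|rewrite inE => /eqP ->; rewrite cn].
  by rewrite cE !r /=; case: ltnP => // kn; rewrite (leq_ltn_trans _ kn).
case: ltnP => kn; last by rewrite mul0n; apply: eq_card0 => s; rewrite inE E ltnNge kn.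
by rewrite mul1n; apply: eq_card => s; rewrite !inE E kn.
Qed.

(** Induction through [rough_count] with [k = 0]: in the identity for [n], whose total is [n] times
    [n!], each term with [0 < j < n] equals [n!]. The last term, [n] times the unknown, is therefore
    [n!] as well. *)
Lemma count_cycle n : 0 < n -> count (single 0) n = (n.-1)`!.
Proof.
elim/ltn_ind: n => -[//|n] IH _.
have := rough_count n.+1 0; rewrite count_rough0 big_ord_recr big_ord_recl /=.
rewrite mul0n muln0 add0n binn mul1n subnn count_rough0 muln1.
rewrite (eq_bigr (fun=> n.+1`!)) => [|i _].
  rewrite sum_nat_const card_ord mulSn addnC => /addnI.
  by rewrite factS => /eqP; rewrite eqn_pmul2l// => /eqP.
rewrite count_rough0 -[bump 0 i]/(i.+1) IH//; last by rewrite ltnS.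
rewrite [i.+1 * _]mulnA -factS bin_fact//.
by rewrite ltnS ltnW.
Qed.

Lemma count_rough_ord0 k : count (rough k) 0 = 1.
Proof.
rewrite -[RHS](count_rough0 0) !countE; apply: eq_card => s; rewrite !inE.
have r j : rough j (porbits s) by apply/forall_inP => c /imsetP[[]].
by rewrite !r.
Qed.

Lemma count_practical n :
  #|[set s : 'S_n | all_below_sum_of_cycle_lengths s]| = count practical n.
Proof.
rewrite countE; apply: eq_card => s; rewrite !inE.
have sz : csize (porbits s) = n.
  rewrite -orbits_inT csize_orbits_in ?cardsT ?card_ord//.
  by apply/forall_inP => x; rewrite inE.
rewrite /practical sz; apply: eq_forallb => m.
have [m0|//] := posnP m; apply/esym/existsP.
by exists set0; rewrite sub0set /csize big_set0 m0.
Qed.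

From mathcomp Require Import all_classical all_reals all_analysis.
From mathcomp Require Import ring lra.

Import numFieldNormedType.Exports.

Local Open Scope ring_scope.
Local Open Scope classical_set_scope.

(** * Permutations without short cycles *)

Section Rough.

Variables (R : realType) (q : nat -> nat -> R).
Hypothesis q0 : forall k, q 0 k = 1.
Hypothesis qrec : forall n k, n%:R * q n k = \sum_(i < n - k) q i k.

Lemma rough_small n k : (0 < n)%N -> (n <= k)%N -> q n k = 0.
Proof.
move=> n0 nk; have := qrec n k.
have -> : (n - k = 0)%N by lia.
rewrite big_ord0 => /eqP; rewrite mulf_eq0 pnatr_eq0.
by case: n n0 {nk} => // n _ /= /eqP.
Qed.

Lemma rough_step n k : (k <= n)%N ->
  n.+1%:R * q n.+1 k = n%:R * q n k + q (n - k) k.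
Proof. by move=> kn; rewrite !qrec subSn// big_ord_recr. Qed.

Lemma rough_ge0 n k : 0 <= q n k.
Proof.
elim/ltn_ind: n => -[|n] IH; first by rewrite q0.
have : 0 <= n.+1%:R * q n.+1 k.
  rewrite qrec sumr_ge0// => i _; apply: IH.
  by have := ltn_ord i; lia.
by rewrite pmulr_rge0.
Qed.

(** For [n > k], [rough_step] makes [q n.+1 k] a weighted mean of two earlier values of positive
    index, and the first nonzero one of these is [q k.+1 k = 1 / (k + 1)]. *)
Lemma rough_le n k : (0 < n)%N -> q n k <= k.+1%:R^-1.
Proof.
elim/ltn_ind: n => -[|n] IH // _.
have [nk|kn] := leqP n.+1 k; first by rewrite rough_small.
have := @rough_step n k kn; have [->|nk] := eqVneq n k.
  rewrite subnn q0; case: k {IH kn} => [|k].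
    by rewrite mul0r add0r mul1r => ->; rewrite invr1.
  rewrite [q k.+1 _]rough_small// mulr0 add0r => E.
  by rewrite -[q _ _](mulKf (x := k.+2%:R)) ?E ?mulr1// pnatr_eq0.
move=> E; have n0 : (0 < n)%N by lia.
rewrite -(ler_pM2l (x := n.+1%:R)) ?ltr0n// E -addn1 natrD mulrDl mul1r.
by apply: lerD; [apply: ler_wpM2l => //; apply: IH | apply: IH; lia].
Qed.

Lemma rough_diff n k : (k <= n)%N ->
  n.+1%:R * (q n.+1 k - q n k) = q (n - k) k - q n k.
Proof.
by move=> kn; rewrite mulrBr rough_step// -addn1 natrD; ring.
Qed.

Lemma rough_diff_norm n k : (k <= n)%N ->
  n.+1%:R * `|q n.+1 k - q n k| = `|q (n - k) k - q n k|.
Proof. by move=> kn; rewrite -rough_diff// normrM normr_nat. Qed.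

Lemma rough_diff_le n k : (k < n)%N ->
  n.+1%:R * `|q n.+1 k - q n k| <= k.+1%:R^-1.
Proof.
move=> kn; rewrite rough_diff_norm; last exact: ltnW.
have := rough_ge0 n k; have := rough_ge0 (n - k) k.
have : q n k <= k.+1%:R^-1 by apply: rough_le; lia.
have : q (n - k) k <= k.+1%:R^-1 by apply: rough_le; lia.
by move: (_^-1) => c *; rewrite ler_norml; lra.
Qed.

Lemma telescope_norm_le (u : nat -> R) m n : (m <= n)%N ->
  `|u n - u m| <= \sum_(m <= i < n) `|u i.+1 - u i|.
Proof. by move=> mn; rewrite -telescope_sumr// ler_norm_sum. Qed.

(* The recursion contracts differences over a window of length [k] by the
   factor [k / n], which forces superpolynomial decay. *)
Lemma rough_diff_decay (d : R) k : (0 < k)%N -> 0 <= d ->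
  (forall n, (5 * k <= n < 6 * k)%N -> `|q n.+1 k - q n k| <= d / k%:R ^+ 2) ->
  forall n, (5 * k <= n)%N ->
  `|q n.+1 k - q n k| <= d * 6 ^+ 6 * k%:R ^+ 4 / n.+1%:R ^+ 6.
Proof.
move=> k0 d0 H; elim/ltn_ind => n IH kn.
have kR : 0 < k%:R :> R by rewrite ltr0n.
have nR : 0 < n.+1%:R :> R by rewrite ltr0n.
(* Below [6 k] the claim is weaker than the hypothesis, because [n + 1 <= 6 k]; this is the origin
   of the factor [6 ^ 6]. *)
have [n6|n6] := ltnP n (6 * k).
  apply: le_trans (H n _) _; first by rewrite kn.
  rewrite [leRHS](_ : _ = d * (6 ^+ 6 * k%:R ^+ 4 / n.+1%:R ^+ 6)); last by rewrite -!mulrA.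
  apply: ler_wpM2l => //; rewrite ler_pdivlMr ?exprn_gt0// mulrC ler_pdivrMr ?exprn_gt0//.
  have -> : 6 ^+ 6 * k%:R ^+ 4 * k%:R ^+ 2 = (6 * k%:R) ^+ 6 :> R by ring.
  rewrite lerXn2r ?nnegrE ?mulr_ge0 ?ler0n//.
  by rewrite -natrM ler_nat.
have kn' : (k <= n)%N by lia.
rewrite -(ler_pM2l nR) rough_diff_norm//.
rewrite distrC; apply: le_trans (telescope_norm_le (q^~ k) (leq_subr k n)) _.
set b := (n - k).+1%:R : R.
have bR : 0 < b by rewrite ltr0n.
have bE : b = n.+1%:R - k%:R by rewrite /b -subSn// natrB// leqW.
have H1 i : (n - k <= i < n)%N -> `|q i.+1 k - q i k| <= d * 6 ^+ 6 * k%:R ^+ 4 / b ^+ 6.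
  move=> /andP[i1 i2]; apply: le_trans (IH i i2 _) _; first by lia.
  apply: ler_wpM2l; first by rewrite !mulr_ge0// exprn_ge0.
  rewrite lef_pV2 ?posrE ?exprn_gt0// ?ltr0n//.
  by rewrite lerXn2r ?nnegrE ?ler0n// ?ler_nat; lia.
apply: (@le_trans _ _ (\sum_(n - k <= i < n) (d * 6 ^+ 6 * k%:R ^+ 4 / b ^+ 6))).
  by apply: ler_sum_nat.
rewrite sumr_const_nat subKn// -[X in X <= _]mulr_natr.
set D := d * 6 ^+ 6 * k%:R ^+ 4.
have D0 : 0 <= D by rewrite !mulr_ge0// exprn_ge0.
rewrite mulrAC -[leLHS]mulrA [leRHS]mulrCA; apply: ler_wpM2l => //.
rewrite ler_pdivrMr ?exprn_gt0// mulrAC ler_pdivlMr ?exprn_gt0//.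
have kb : 5 * k%:R <= b.
  have : (6 * k)%:R <= n%:R :> R by rewrite ler_nat.
  by rewrite bE natrM -natr1; lra.
have -> : n.+1%:R = b + k%:R by rewrite bE subrK.
rewrite exprS mulrCA; apply: ler_wpM2l; first by rewrite addr_ge0// ltW.
(* Since [k <= b / 5], the required [k (b + k) ^ 5 <= b ^ 6] comes down to [(6 / 5) ^ 5 / 5 <= 1],
   which limits the exponent of the decay. *)
have H2 : b + k%:R <= 6 / 5 * b by lra.
apply: (@le_trans _ _ (b / 5 * (6 / 5 * b) ^+ 5)).
  apply: ler_pM => //.
  - by rewrite exprn_ge0// addr_ge0// ltW.
  - by rewrite ler_pdivlMr// mulrC.
  - by rewrite lerXn2r// nnegrE ?addr_ge0 ?mulr_ge0 ?divr_ge0// ltW.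
have -> : b / 5 * (6 / 5 * b) ^+ 5 = (6 / 5) ^+ 5 / 5 * b ^+ 6.
  by rewrite exprMn exprS; ring.
apply: ler_piMl; first by rewrite exprn_ge0// ltW.
by lra.
Qed.

End Rough.

(** * Limits in the first argument and Buchstab's identity *)

Section RoughLimit.

Variables (R : realType) (q : nat -> nat -> R).
Hypothesis q0 : forall k, q 0 k = 1.
Hypothesis qrec : forall n k, n%:R * q n k = \sum_(i < n - k) q i k.

(** Lets the bound of [rough_diff_decay] telescope. For [a = 1 / i] and [b = 1 / (i + 1)] one has
    [a - b = a b], so [a ^ 5 - b ^ 5 >= 5 b ^ 4 (a - b) >= 5 b ^ 6]. *)
Lemma invX_diff_ge (i : nat) : (0 < i)%N ->
  5 / i.+1%:R ^+ 6 <= i%:R ^- 5 - i.+1%:R ^- 5 :> R.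
Proof.
move=> i0; have iR : 0 < i%:R :> R by rewrite ltr0n.
set a := i%:R^-1 : R; set b := i.+1%:R^-1 : R.
have a0 : 0 < a by rewrite invr_gt0.
have b0 : 0 < b by rewrite invr_gt0.
have ab : a - b = a * b.
  by rewrite /a /b -natr1; field; rewrite natr1 !pnatr_eq0 /=; lia.
have ba : b <= a by rewrite -subr_ge0 ab mulr_ge0// ltW.
rewrite -!exprVn -/a -/b.
have -> : a ^+ 5 - b ^+ 5 = (a - b) ^+ 2 *
  (a ^+ 3 + 2 * a ^+ 2 * b + 3 * a * b ^+ 2 + 4 * b ^+ 3) + 5 * b ^+ 4 * (a - b).
  by ring.
apply: ler_wpDl.
  have [a0' b0'] := (ltW a0, ltW b0).
  apply: mulr_ge0; first exact: sqr_ge0.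
  by rewrite !addr_ge0 ?mulr_ge0 ?exprn_ge0 ?mulr_ge0 ?exprn_ge0.
rewrite ab -mulrA; apply: ler_wpM2l => //.
rewrite (_ : b ^+ 6 = b ^+ 4 * (b * b)); last by ring.
by rewrite ler_wpM2l ?exprn_ge0 ?ler_wpM2r// ltW.
Qed.

Lemma rough_tail (d : R) k : (0 < k)%N -> 0 <= d ->
  (forall n, (5 * k <= n < 6 * k)%N -> `|q n.+1 k - q n k| <= d / k%:R ^+ 2) ->
  forall m n, (5 * k <= m)%N -> (m <= n)%N ->
  `|q n k - q m k| <= d * 6 ^+ 6 / 5 * k%:R ^+ 4 / m%:R ^+ 5.
Proof.
move=> k0 d0 H m n km mn.
have m0 : (0 < m)%N by lia.
apply: le_trans (telescope_norm_le (q^~ k) mn) _.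
set D := d * 6 ^+ 6 / 5 * k%:R ^+ 4.
have D0 : 0 <= D by rewrite !mulr_ge0// exprn_ge0.
apply: (@le_trans _ _ (\sum_(m <= i < n) (D * i%:R ^- 5 - D * i.+1%:R ^- 5))).
  apply: ler_sum_nat => i /andP[mi _].
  have E := rough_diff_decay qrec k0 d0 H (leq_trans km mi).
  apply: (le_trans E).
  rewrite -mulrBr.
  apply: le_trans (ler_wpM2l D0 (invX_diff_ge _)); last by lia.
  rewrite /D; move: (i.+1%:R ^- 6) => X.
  by rewrite le_eqVlt; apply/orP; left; apply/eqP; field.
rewrite (@telescope_sumr_eq _ m n (fun i => - (D * i%:R ^- 5)))//; last first.
  by move=> i _; rewrite opprK addrC.
by rewrite opprK addrC gerBl mulr_ge0// invr_ge0 exprn_ge0.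
Qed.

(** This is [rough_tail] with [d = 1], which [rough_diff_le] permits. As [m >= 5 k], a factor
    [k ^ 2 / m ^ 2] is at most [1 / 25], and [6 ^ 6 / 125 < 374]. *)
Lemma rough_tail_crude k m n : (0 < k)%N -> (5 * k <= m)%N -> (m <= n)%N ->
  `|q n k - q m k| <= 374 * k%:R ^+ 2 / m%:R ^+ 3.
Proof.
move=> k0 km mn; have kR : 0 < k%:R :> R by rewrite ltr0n.
have mR : 0 < m%:R :> R by rewrite ltr0n; lia.
apply: le_trans (@rough_tail 1 k k0 _ _ m n km mn) _ => //.
  move=> i /andP[ki _]; rewrite ler_pdivlMr ?exprn_gt0//.
  have ki' : (k < i)%N by lia.
  rewrite -(@ler_pM2l _ i.+1%:R) ?ltr0n// mulrA mulr1.
  apply: le_trans (ler_wpM2r _ (rough_diff_le q0 qrec ki')) _.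
    by rewrite exprn_ge0.
  rewrite ler_pdivrMl ?ltr0n// -natrX -natrM ler_nat.
  by rewrite expnS expn1 leq_mul//; lia.
rewrite ler_pdivrMr ?exprn_gt0// [leRHS]mulrAC ler_pdivlMr ?exprn_gt0//.
have H : 25 * k%:R ^+ 2 <= m%:R ^+ 2 :> R.
  have -> : 25 * k%:R ^+ 2 = (5 * k%:R) ^+ 2 :> R by ring.
  rewrite lerXn2r ?nnegrE ?mulr_ge0// -natrM ler_nat; lia.
have -> : 1 * 6 ^+ 6 / 5 * k%:R ^+ 4 * m%:R ^+ 3 =
   6 ^+ 6 / 125 * (k%:R ^+ 2 * m%:R ^+ 3) * (25 * k%:R ^+ 2) :> R by field.
have -> : 374 * k%:R ^+ 2 * m%:R ^+ 5 =
   374 * (k%:R ^+ 2 * m%:R ^+ 3) * m%:R ^+ 2 :> R by ring.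
have P : 0 <= k%:R ^+ 2 * m%:R ^+ 3 :> R by rewrite mulr_ge0// exprn_ge0.
apply: ler_pM => //; rewrite ?mulr_ge0// ?exprn_ge0//.
by apply: ler_wpM2r => //; lra.
Qed.


Lemma cvgn_of_dist_le (u : nat -> R) (e : nat -> R) N :
  (forall m n, (N <= m)%N -> (m <= n)%N -> `|u n - u m| <= e m) ->
  e @ \oo --> 0 -> cvgn u.
Proof.
move=> H He; apply/cauchy_cvgP/cauchy_exP => eps eps0.
have [m _ Hm] : \forall m \near \oo, `|e m| < eps.
  by move/cvgrPdist_lt : He => /(_ _ eps0); apply: filterS => m; rewrite sub0r normrN.
exists (u (maxn m N)); exists (maxn m N) => // n /= mn.
rewrite /ball /= distrC; apply: le_lt_trans (H _ _ _ mn) _; first by rewrite leq_maxr.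
by apply: le_lt_trans (ler_norm _) (Hm _ _); rewrite /= leq_maxl.
Qed.

Lemma cvgn_scale_invX (c : R) a : (0 < a)%N -> (fun n => c / n%:R ^+ a) @ \oo --> (0 : R).
Proof.
move=> a0; rewrite -[X in _ --> X](mulr0 c); apply: cvgM; first exact: cvg_cst.
apply/cvgrPdist_le => eps eps0; near=> n.
have n0 : 0 < n%:R :> R by rewrite ltr0n; near: n; exists 1%N.
rewrite sub0r normrN ger0_norm ?invr_ge0 ?exprn_ge0//.
apply: (@le_trans _ _ n%:R^-1).
  rewrite lef_pV2 ?posrE ?exprn_gt0//.
  case: a a0 => // a _; rewrite exprS.
  by apply: ler_peMr; [exact: ltW|rewrite exprn_ege1// ler1n -(ltr0n R)].
rewrite invf_ple ?posrE//; near: n; exact: nbhs_infty_ger.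
Unshelve. all: by end_near. Qed.

Lemma rough_cvg k : (0 < k)%N -> cvgn (q^~ k).
Proof.
move=> k0.
apply: (@cvgn_of_dist_le _ (fun m => 374 * k%:R ^+ 2 / m%:R ^+ 3) (5 * k)).
  by move=> m n km mn; apply: rough_tail_crude.
exact: cvgn_scale_invX.
Qed.

Definition rough_lim k : R := lim (q^~ k @ \oo).

Lemma rough_lim_ge0 k : (0 < k)%N -> 0 <= rough_lim k.
Proof.
by move=> k0; apply: limr_ge; [exact: rough_cvg|near=> n; exact: (rough_ge0 q0 qrec)].
Unshelve. all: by end_near. Qed.

Lemma rough_lim_le k : (0 < k)%N -> rough_lim k <= k%:R^-1.
Proof.
move=> k0; apply: limr_le; first exact: rough_cvg.
near=> n; apply: le_trans (rough_le q0 qrec _ _) _; first by near: n; exists 1%N.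
by rewrite lef_pV2 ?posrE ?ltr0n// ler_nat.
Unshelve. all: by end_near. Qed.

(** For [n >= 5 k], let the upper index of [rough_tail_crude] go to infinity. For [n < 5 k], both
    numbers lie in [[0, 1 / k]] and [n ^ 3 < 125 k ^ 3]. The constant 400 covers both cases. *)
Lemma rough_lim_dist n k : (0 < k)%N -> (0 < n)%N ->
  `|q n k - rough_lim k| <= 400 * k%:R ^+ 2 / n%:R ^+ 3.
Proof.
move=> k0 n0; have [kn|nk] := leqP (5 * k) n.
  apply: (@le_trans _ _ (374 * k%:R ^+ 2 / n%:R ^+ 3)); last first.
    apply: ler_wpM2r; first by rewrite invr_ge0 exprn_ge0.
    by apply: ler_wpM2r; [rewrite exprn_ge0|lra].
  rewrite distrC.
  have H : (fun m => `|q m k - q n k|) @ \oo --> `|rough_lim k - q n k|.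
    by apply: cvg_norm; apply: cvgB; [exact: rough_cvg|exact: cvg_cst].
  rewrite -(cvg_lim _ H)//; apply: limr_le; first by apply/cvg_ex; eexists; exact: H.
  by exists n => // m /= nm; apply: rough_tail_crude.
have kR : 0 < k%:R :> R by rewrite ltr0n.
have nR : 0 < n%:R :> R by rewrite ltr0n.
apply: (@le_trans _ _ (k%:R^-1)).
  have h1 : q n k <= k%:R^-1.
    apply: le_trans (rough_le q0 qrec _ n0) _.
    by rewrite lef_pV2 ?posrE ?ltr0n// ler_nat.
  have := rough_lim_le k0; have := rough_lim_ge0 k0.
  have := rough_ge0 q0 qrec n k; move: h1.
  by move: (_^-1) => c *; rewrite ler_norml; lra.
rewrite ler_pdivlMr ?exprn_gt0// ler_pdivrMl// mulrCA -exprS.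
apply: (@le_trans _ _ ((5 * k%:R) ^+ 3)).
  by rewrite lerXn2r ?nnegrE ?mulr_ge0// -natrM ler_nat ltnW.
by rewrite exprMn ler_wpM2r ?exprn_ge0//; lra.
Qed.

(* Shifted value, with [0] replacing the truncated subtraction. *)
Definition shifted n j k : R := if (j <= n)%N then q (n - j) k else 0.

Lemma shifted0 n k : shifted n 0 k = q n k.
Proof. by rewrite /shifted subn0. Qed.

Lemma shifted_ge0 n j k : 0 <= shifted n j k.
Proof. by rewrite /shifted; case: ifP => // _; apply: (rough_ge0 q0 qrec). Qed.

Lemma sum_shifted n j k : \sum_(i < n) shifted i j k = \sum_(i < n - j) q i k.
Proof.
elim: n => [|n IH]; first by rewrite sub0n !big_ord0.
rewrite big_ord_recr /= IH /shifted; case: leqP => jn.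
  by rewrite subSn// big_ord_recr.
have -> : (n.+1 - j = n - j)%N by lia.
by rewrite addr0.
Qed.

Lemma rough_mean n k : n%:R * q n k = \sum_(i < n) shifted i k k.
Proof. by rewrite sum_shifted qrec. Qed.

Lemma shifted_rec n j k :
  n%:R * shifted n j k = \sum_(i < n - k) shifted i j k + j%:R * shifted n j k.
Proof.
rewrite {1 3}/shifted; case: leqP => jn; last first.
  rewrite !mulr0 addr0 big1// => i _; rewrite /shifted ifF//.
  by apply/negbTE; rewrite -ltnNge; have := ltn_ord i; lia.
rewrite -{1}(subnK jn) natrD mulrDl qrec sum_shifted; congr (_ + _).
by rewrite subnAC.
Qed.

Lemma rough_k0 n : q n 0 = 1.
Proof.
elim/ltn_ind: n => -[|n] IH; first exact: q0.
have := qrec n.+1 0; rewrite subn0 (eq_bigr (fun=> 1)); last by move=> i _; exact: IH.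
rewrite sumr_const card_ord => E.
by apply: (@mulfI _ n.+1%:R); rewrite ?pnatr_eq0// E mulr1.
Qed.

(* Buchstab's identity: classify by the number [i] of cycles of length [k]. *)
Lemma rough_buchstab n k I : (n < I)%N ->
  q n k = \sum_(i < I) shifted n (i * k.+1) k.+1 / (i`!%:R * k.+1%:R ^+ i).
Proof.
pose c i : R := (i`!%:R * k.+1%:R ^+ i)^-1.
elim/ltn_ind: n I => n IH I nI.
case: n => [|n] in IH nI *.
  rewrite q0; case: I nI => // I _; rewrite big_ord_recl big1 => [|i _].
    by rewrite mul0n shifted0 q0 fact0 expr0 mulr1 divr1 addr0.
  by rewrite /shifted lift0 mulSn mul0r.
apply: (@mulfI _ n.+1%:R); first by rewrite pnatr_eq0.
rewrite qrec mulr_sumr.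
have [nk|kn] := leqP n.+1 k.
  have -> : (n.+1 - k = 0)%N by lia.
  rewrite big_ord0 big1// => -[[|i] iI] _ /=.
    by rewrite mul0n shifted0 rough_small ?mul0r ?mulr0//; lia.
  by rewrite /shifted ifF ?mul0r ?mulr0//; apply/negbTE; rewrite -ltnNge mulSn; lia.
(* The last term [q (n - k) k] of the recursion matches the second parts given by [shifted_rec]:
   lowering [i] by one turns their sum into the expansion of [q (n - k) k] itself. *)
have -> : (n.+1 - k = (n.+1 - k.+1).+1)%N by lia.
rewrite big_ord_recr /=.
rewrite (eq_bigr (fun i : 'I_I =>
   \sum_(j < n.+1 - k.+1) shifted j (i * k.+1) k.+1 * c i +
   (i * k.+1)%:R * shifted n.+1 (i * k.+1) k.+1 * c i)); last first.
  by move=> i _; rewrite mulrA shifted_rec mulrDl mulr_suml.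
rewrite big_split /= exchange_big /=; congr (_ + _).
  by apply: eq_bigr => i _; apply: IH; have := ltn_ord i; lia.
rewrite (IH _ _ I); try lia.
case: I nI => // I nI.
rewrite [LHS]big_ord_recr [RHS]big_ord_recl /= mul0n !mul0r add0r.
rewrite [shifted _ (I * _) _]/shifted ifF ?mul0r ?addr0; last first.
  by apply/negbTE; rewrite -ltnNge mulnS; lia.
apply: eq_bigr => i _; rewrite /bump /= add1n.
have -> : shifted n.+1 (i.+1 * k.+1) k.+1 = shifted (n.+1 - k.+1) (i * k.+1) k.+1.
  rewrite /shifted mulSn -subnDA leq_subRL; last by lia.
  by [].
have -> : (i`!%:R * k.+1%:R ^+ i)^-1 = (i.+1 * k.+1)%:R * c i.+1.
  rewrite /c factS exprS !natrM.
  have h1 : i`!%:R != 0 :> R by rewrite pnatr_eq0 -lt0n fact_gt0.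
  have h2 : k.+1%:R ^+ i != 0 :> R by rewrite expf_neq0// pnatr_eq0.
  have h3 : k.+1%:R != 0 :> R by rewrite pnatr_eq0.
  have h4 : i.+1%:R != 0 :> R by rewrite pnatr_eq0.
  by rewrite mulrACA [in RHS]invfM mulrA divff ?mul1r// mulf_neq0.
by rewrite mulrCA mulrA.
Qed.

Lemma sum_exp_coeff_le (x : R) n : 0 <= x ->
  \sum_(i < n) x ^+ i / i`!%:R <= expR x.
Proof.
move=> x0; rewrite /expR.
have -> : \sum_(i < n) x ^+ i / i`!%:R = series (exp_coeff x) n.
  by rewrite /series /= big_mkord.
apply: nondecreasing_cvgn_le; last exact: is_cvg_series_exp_coeff.
by apply/nondecreasing_seqP => m; rewrite seriesSr lerDl exp_coeff_ge0.
Qed.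

Lemma cvg_exp_coeff (x : R) : (fun n => \sum_(i < n) x ^+ i / i`!%:R) @ \oo --> expR x.
Proof.
have := @is_cvg_series_exp_coeff R x.
rewrite /expR (_ : (fun n => _) = series (exp_coeff x))//.
by apply/funext => n; rewrite /series /= big_mkord.
Qed.

(** Holds because [i + 1 <= 2 ^ i], so the cube is at most [8 ^ i]. It sums errors that grow like
    [i ^ 3] over the terms of Buchstab's identity. *)
Lemma sum_cube_fact_le n : \sum_(i < n) i.+1%:R ^+ 3 / i`!%:R <= expR 8 :> R.
Proof.
apply: le_trans (@sum_exp_coeff_le 8 n _) => //; apply: ler_sum => i _.
rewrite ler_wpM2r ?invr_ge0//.
have -> : 8 = 2 ^+ 3 :> R by ring.
rewrite exprAC lerXn2r ?nnegrE ?exprn_ge0// -natrX ler_nat.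
exact/ltn_expl.
Qed.

(** The indicator covers [i k = n], where the shifted value is [q 0 k = 1]. If [2 i k <= n], the
    index [n - i k] is at least [n / 2], at the cost of a factor [2 ^ 3]; otherwise both numbers lie
    in [[0, 1 / k]] and [n < 2 i k]. *)
Lemma shifted_dist_pos n i k : (0 < n)%N -> (0 < i)%N -> (0 < k)%N ->
  `|shifted n (i * k) k - rough_lim k| <=
    400 * 2 ^+ 3 * i%:R ^+ 3 * k%:R ^+ 2 / n%:R ^+ 3 + (i * k == n)%N%:R.
Proof.
have [B BE B1] : exists2 B : R, B = 400 & 1 <= B by exists 400 => //; lra.
have B0 : 0 <= B by apply: le_trans B1.
rewrite -BE; move=> n0 i0 k0; have nR : 0 < n%:R :> R by rewrite ltr0n.
have kR : 0 < k%:R :> R by rewrite ltr0n.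
have iR : 0 < i%:R :> R by rewrite ltr0n.
have A0 : 0 <= B * 2 ^+ 3 * i%:R ^+ 3 * k%:R ^+ 2 / n%:R ^+ 3 :> R.
  apply: divr_ge0; last exact: exprn_ge0.
  apply: mulr_ge0; last exact: exprn_ge0.
  apply: mulr_ge0; last exact: exprn_ge0.
  by apply: mulr_ge0.
have L0 := rough_lim_ge0 k0; have L1 := rough_lim_le k0.
have [->|ne] := eqVneq (i * k)%N n.
  rewrite /shifted leqnn subnn q0; apply: (@le_trans _ _ 1); last by rewrite lerDr.
  have : k%:R^-1 <= 1 :> R by rewrite invf_le1// ler1n.
  by move: L1; move: (_^-1) => c *; rewrite ler_norml; lra.
rewrite addr0; have [big|small] := leqP (2 * (i * k)) n.
  rewrite /shifted ifT; last by lia.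
  rewrite [B]BE; apply: le_trans (rough_lim_dist k0 _) _; first by lia.
  rewrite -BE.
  rewrite ler_pdivrMr ?exprn_gt0// ?ltr0n; last by lia.
  rewrite mulrAC ler_pdivlMr ?exprn_gt0//.
  have H : n%:R <= 2 * (n - i * k)%:R :> R by rewrite -natrM ler_nat; lia.
  have I1 : 1 <= i%:R ^+ 3 :> R by rewrite exprn_ege1// ler1n.
  apply: (@le_trans _ _ (B * k%:R ^+ 2 * (2 * (n - i * k)%:R) ^+ 3)).
    apply: ler_wpM2l; first by rewrite mulr_ge0// exprn_ge0.
    by rewrite lerXn2r ?nnegrE ?mulr_ge0//.
  have -> : B * 2 ^+ 3 * i%:R ^+ 3 * k%:R ^+ 2 * (n - i * k)%:R ^+ 3 =
    B * k%:R ^+ 2 * (2 * (n - i * k)%:R) ^+ 3 * i%:R ^+ 3 :> R by ring.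
  apply: ler_peMr => //; apply: mulr_ge0; first by rewrite mulr_ge0// exprn_ge0.
  by rewrite exprn_ge0// mulr_ge0.
apply: (@le_trans _ _ k%:R^-1).
  have : 0 <= shifted n (i * k) k <= k%:R^-1.
    rewrite shifted_ge0 /shifted; case: ifP => [ikn|_] /=; last by rewrite invr_ge0.
    apply: le_trans (rough_le q0 qrec _ _) _; first by lia.
    by rewrite lef_pV2 ?posrE ?ltr0n// ler_nat.
  by move: L1; move: (_^-1) => c L1 /andP[? ?]; rewrite ler_norml; lra.
rewrite ler_pdivlMr ?exprn_gt0// ler_pdivrMl//.
apply: (@le_trans _ _ ((2 * (i * k)%:R) ^+ 3)).
  by rewrite lerXn2r ?nnegrE ?mulr_ge0// -natrM ler_nat ltnW.
rewrite natrM [leRHS](_ : _ = B * (2 * (i%:R * k%:R)) ^+ 3); last by ring.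
by rewrite ler_peMl ?exprn_ge0 ?mulr_ge0.
Qed.

Lemma shifted_dist : exists2 C : R, 0 <= C & forall n i k, (0 < n)%N -> (0 < k)%N ->
  `|shifted n (i * k) k - rough_lim k| <=
    C * i.+1%:R ^+ 3 * k%:R ^+ 2 / n%:R ^+ 3 + (i * k == n)%N%:R.
Proof.
have [B BE B1] : exists2 B : R, B = 400 & 1 <= B by exists 400 => //; lra.
have B0 : 0 <= B by apply: le_trans B1.
exists (B * 2 ^+ 3) => [|n i k n0 k0]; first by rewrite mulr_ge0// exprn_ge0.
have C0 : 0 <= B * 2 ^+ 3 by rewrite mulr_ge0// exprn_ge0.
have nR : 0 <= (n%:R ^+ 3)^-1 :> R by rewrite invr_ge0 exprn_ge0.
have kR : 0 <= k%:R ^+ 2 :> R by rewrite exprn_ge0.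
case: i => [|i].
  rewrite mul0n shifted0 expr1n mulr1 eq_sym (gtn_eqF n0) addr0.
  have := rough_lim_dist k0 n0; rewrite -BE => /le_trans; apply.
  do 2!apply: ler_wpM2r => //; apply: ler_peMr => //.
  by rewrite exprn_ege1// ler1n.
have := @shifted_dist_pos n i.+1 k n0 isT k0; rewrite -BE => /le_trans; apply.
rewrite lerD2r.
do 2!apply: ler_wpM2r => //; apply: ler_wpM2l => //.
by rewrite lerXn2r ?nnegrE// ler_nat.
Qed.

End RoughLimit.

(** * The limit of the rough proportions and the renewal defect *)

Section RoughDefect.

Variables (R : realType) (q : nat -> nat -> R).
Hypothesis q0 : forall k, q 0 k = 1.
Hypothesis qrec : forall n k, n%:R * q n k = \sum_(i < n - k) q i k.

Local Notation l := (rough_lim q).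

(** Let [n] go to infinity in Buchstab's identity: every shifted term tends to [l k.+1], and the
    coefficients add up to [exp (1 / (k + 1))]. The factorials make the convergence uniform in
    [i]. *)
Lemma rough_lim_step k : l k = expR k.+1%:R^-1 * l k.+1.
Proof.
set K := k.+1; have K0 : (0 < K)%N by [].
have [C C0 HC] := shifted_dist q0 qrec.
pose e n : R := (C * K%:R ^+ 2 / n%:R ^+ 3 + K%:R / n%:R ^+ 1) * expR 8.
pose u n : R := \sum_(i < n.+1) K%:R^-1 ^+ i / i`!%:R.
have e_cvg : e @ \oo --> 0.
  rewrite -[X in _ --> X](mul0r (expR 8)); apply: cvgM; last exact: cvg_cst.
  rewrite -[X in _ --> X]addr0; apply: cvgD; exact: cvgn_scale_invX.
have u_cvg : u @ \oo --> expR K%:R^-1.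
  have H := @cvg_exp_coeff R K%:R^-1; rewrite -cvg_shiftS in H; exact: H.
have bound n : (0 < n)%N -> `|q n k - u n * l K| <= e n.
  move=> n0; have nR : 0 < n%:R :> R by rewrite ltr0n.
  rewrite (rough_buchstab q0 qrec k (ltnSn n)) -/K mulr_suml -sumrB.
  apply: le_trans (ler_norm_sum _ _ _) _; rewrite /e.
  apply: le_trans (ler_wpM2l _ (@sum_cube_fact_le R n.+1)); last first.
    by rewrite addr_ge0// divr_ge0 ?mulr_ge0 ?exprn_ge0.
  rewrite mulr_sumr; apply: ler_sum => i _.
  have f0 : 0 < i`!%:R :> R by rewrite ltr0n fact_gt0.
  have K1 : 1 <= K%:R ^+ i :> R by rewrite exprn_ege1// ler1n.
  have -> : shifted q n (i * K) K / (i`!%:R * K%:R ^+ i) - K%:R^-1 ^+ i / i`!%:R * l K =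
     (shifted q n (i * K) K - l K) / K%:R ^+ i / i`!%:R.
    rewrite exprVn invfM; ring.
  rewrite normrM normfV (ger0_norm (ltW f0)) mulrA; apply: ler_wpM2r; first by rewrite invr_ge0 ltW.
  have K2 : 0 < K%:R ^+ i :> R by apply: lt_le_trans K1.
  rewrite normrM normfV (ger0_norm (ltW K2)) ler_pdivrMr//.
  apply: le_trans (HC n i K n0 K0) _; rewrite -[leLHS]mulr1.
  have i1 : 1 <= i.+1%:R :> R by rewrite ler1n.
  have P1 : 0 <= C * K%:R ^+ 2 / n%:R ^+ 3 by rewrite divr_ge0 ?mulr_ge0 ?exprn_ge0.
  have P2 : 0 <= K%:R / n%:R ^+ 1 :> R by rewrite divr_ge0.
  apply: ler_pM => //.
    by rewrite addr_ge0 ?divr_ge0 ?mulr_ge0 ?exprn_ge0.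
  rewrite mulrDl; apply: lerD.
    have -> : C * i.+1%:R ^+ 3 * K%:R ^+ 2 / n%:R ^+ 3 =
      C * K%:R ^+ 2 / n%:R ^+ 3 * i.+1%:R ^+ 3 by ring.
    by [].
  (* If [i K = n] then [K / n = 1 / i], so the indicator is at most [(K / n) (i + 1) ^ 3]. *)
  case: eqP => [iKn|_]; last by rewrite mulr_ge0// exprn_ge0.
  have -> : n%:R = i%:R * K%:R :> R by rewrite -natrM iKn.
  rewrite expr1.
  have i0 : 0 < i%:R :> R by rewrite ltr0n; case: (nat_of_ord i) iKn n0 => // <-.
  have -> : K%:R / (i%:R * K%:R) = i%:R^-1 :> R.
    by rewrite invfM mulrCA divff ?mulr1// pnatr_eq0.
  rewrite ler_pdivlMl// mulr1.
  apply: (@le_trans _ _ i.+1%:R); first by rewrite ler_nat.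
  by rewrite exprS ler_peMr// exprn_ege1.
have lim0 : (fun n => q n k - u n * l K) @ \oo --> 0.
  apply/norm_cvg0P; apply: (@squeeze_cvgr _ _ _ _ (fun=> 0) e) => //; last exact: cvg_cst.
  by exists 1%N => // n n0 /=; rewrite normr_ge0 bound.
have H : (fun n => (q n k - u n * l K) + u n * l K) @ \oo --> 0 + expR K%:R^-1 * l K.
  by apply: cvgD => //; apply: cvgM => //; exact: cvg_cst.
rewrite add0r in H; rewrite {1}/rough_lim; apply: cvg_lim => //.
by apply: cvg_trans H; apply: near_eq_cvg; apply: nearW => n; rewrite subrK.
Qed.

Lemma rough_limE k : l k = expR (- series harmonic k).
Proof.
elim: k => [|k IH].
  rewrite /series /= big_nil oppr0 expR0; apply: cvg_lim => //.
  rewrite (_ : q^~ 0%N = fun=> 1); first exact: cvg_cst.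
  by apply/funext => n; exact: (rough_k0 q0 qrec).
have := rough_lim_step k; rewrite IH seriesSr /= opprD expRD => ->.
by rewrite mulrAC -expRD subrr expR0 mul1r.
Qed.

(** The left-hand side of the difference between equation [N] and the mean equation at [K], with
    [1 / k] in place of [P k.-1]. *)
Definition rough_defect N K : R :=
  \sum_(1 <= k < N.+1) (shifted q N k k - q K k) / k%:R.

Definition buchstab_coef i k : R := (i`!%:R * k%:R ^+ i)^-1.

Definition buchstab_tail I n k : R :=
  \sum_(2 <= i < I) shifted q n (i * k) k * buchstab_coef i k.

Lemma buchstab_split I n k : (n < I)%N -> (1 < I)%N ->
  q n k = q n k.+1 + shifted q n k.+1 k.+1 / k.+1%:R + buchstab_tail I n k.+1.
Proof.
move=> nI I1; rewrite (rough_buchstab q0 qrec k nI).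
rewrite -(big_mkord xpredT (fun i => shifted q n (i * k.+1) k.+1 / (i`!%:R * k.+1%:R ^+ i))).
rewrite big_ltn; last exact: ltnW.
rewrite big_ltn// mul0n shifted0 fact0 expr0 mulr1 divr1 mul1n expr1.
by rewrite [1`!]/= mul1r addrA.
Qed.

(** Solved for its term [i = 1], Buchstab's identity telescopes in [k], from [q n 0 = 1] to
    [q n N = 0]. *)
Lemma sum_shifted_diag I n N : (0 < n)%N -> (n <= N)%N -> (n < I)%N ->
  \sum_(1 <= k < N.+1) shifted q n k k / k%:R =
  1 - \sum_(1 <= k < N.+1) buchstab_tail I n k.
Proof.
move=> n0 nN nI; apply/eqP; rewrite eq_sym subr_eq -big_split /=; apply/eqP.
rewrite big_add1 /=.
rewrite (@telescope_sumr_eq _ 0 N (fun k => - q n k))//; last first.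
  move=> k _; rewrite opprK addrC; apply/eqP.
  rewrite (buchstab_split k nI); last by apply: leq_ltn_trans nI.
  by rewrite -(addrA (q n k.+1)) addKr addrC.
by rewrite opprK (rough_small qrec)// oppr0 add0r (rough_k0 q0 qrec).
Qed.

(** Adds up [sum_shifted_diag] over [0 < j < K]. The index 0 contributes nothing, hence [K - 1]. *)
Lemma sum_mean_diag I N K : (0 < K)%N -> (K <= N)%N -> (K < I)%N ->
  K%:R * \sum_(1 <= k < N.+1) q K k / k%:R =
  K%:R - 1 - \sum_(1 <= k < N.+1) \sum_(j < K) buchstab_tail I j k.
Proof.
move=> K0 KN KI; rewrite mulr_sumr.
under eq_bigr => k _ do rewrite mulrA rough_mean// mulr_suml.
rewrite exchange_big [in RHS]exchange_big /=.
case: K K0 KN KI => // K _ KN KI.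
rewrite !big_ord_recl /= big1_seq => [|k]; last first.
  rewrite mem_index_iota => /andP[_ /andP[k1 _]].
  by rewrite /shifted leqn0 gtn_eqF ?mul0r.
rewrite [X in _ = _ - (X + _)]big1_seq => [|k]; last first.
  rewrite mem_index_iota => /andP[_ /andP[k1 _]].
  rewrite /buchstab_tail big1_seq// => i; rewrite mem_index_iota => /andP[_ /andP[i2 _]].
  by rewrite /shifted leqn0 muln_eq0 !gtn_eqF ?mul0r//; lia.
rewrite !add0r (eq_bigr (fun i : 'I_K => 1 - \sum_(1 <= k < N.+1) buchstab_tail I (lift ord0 i) k)).
  by rewrite sumrB sumr_const card_ord -[K.+1%:R]natr1 addrK.
move=> i _; have := ltn_ord i => iK.
rewrite lift0 -[bump 0 i]/(i.+1).
by apply: sum_shifted_diag; rewrite //; lia.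
Qed.

Lemma rough_defectE I N K : (0 < K)%N -> (K <= N)%N -> (N < I)%N ->
  rough_defect N K = K%:R^-1 - \sum_(1 <= k < N.+1) \sum_(2 <= i < I)
    (shifted q N (i * k) k - K%:R^-1 * \sum_(j < K) shifted q j (i * k) k) *
    buchstab_coef i k.
Proof.
move=> K0 KN NI; have K1 : K%:R != 0 :> R by rewrite pnatr_eq0 -lt0n.
have E : \sum_(1 <= k < N.+1) q K k / k%:R =
  1 - K%:R^-1 - K%:R^-1 * \sum_(1 <= k < N.+1) \sum_(j < K) buchstab_tail I j k.
  apply: (mulfI K1); rewrite (@sum_mean_diag I)//; last exact: leq_ltn_trans NI.
  by rewrite !mulrBr mulr1 mulfV// mulVKf.
rewrite /rough_defect; under eq_bigr => k _ do rewrite mulrBl.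
rewrite sumrB E (@sum_shifted_diag I)//; last exact: leq_trans KN.
under [in RHS]eq_bigr => k _ do under eq_bigr => i _ do rewrite mulrBl -mulrA.
under [in RHS]eq_bigr => k _ do rewrite sumrB.
rewrite [in RHS]sumrB.
have -> : \sum_(1 <= k < N.+1) \sum_(2 <= i < I)
    K%:R^-1 * ((\sum_(j < K) shifted q j (i * k) k) * buchstab_coef i k) =
    K%:R^-1 * \sum_(1 <= k < N.+1) \sum_(j < K) buchstab_tail I j k.
  rewrite mulr_sumr; apply: eq_bigr => k _.
  rewrite -mulr_sumr /buchstab_tail exchange_big /=; congr (_ * _).
  by apply: eq_bigr => i _; rewrite mulr_suml.
rewrite /buchstab_tail; ring.
Qed.

(** As [K - i k = (K - (i - 1) k) - k], the recursion turns the mean into [(K - (i - 1) k) / K]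
    times a single value of [q], close to [l k]. If [(i - 1) k >= K] the mean is 0 and the main term
    is within the error. *)
Lemma mean_shifted_dist : exists2 C : R, 0 <= C & forall K i k, (0 < K)%N ->
  (1 < i)%N -> (0 < k)%N ->
  `|K%:R^-1 * \sum_(j < K) shifted q j (i * k) k -
    l k * (1 - i.-1%:R * k%:R / K%:R)| <= C * i.+1%:R ^+ 3 * k%:R ^+ 2 / K%:R ^+ 3.
Proof.
have [C C0 HC] := shifted_dist q0 qrec.
exists (C + 1) => [|K i k K0 i1 k0]; first by rewrite addr_ge0.
have KR : 0 < K%:R :> R by rewrite ltr0n.
have kR : 0 < k%:R :> R by rewrite ltr0n.
have K3 : 0 <= (K%:R ^+ 3)^-1 :> R by rewrite invr_ge0 exprn_ge0.
have k2 : 0 <= k%:R ^+ 2 :> R by rewrite exprn_ge0.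
have i3 : 0 <= i.+1%:R ^+ 3 :> R by rewrite exprn_ge0.
rewrite sum_shifted; have -> : (K - i * k = K - i.-1 * k - k)%N.
  by case: i i1 {i3} => //= i _; rewrite mulSn addnC subnDA.
rewrite -qrec; have [small|large] := ltnP (i.-1 * k) K; last first.
  have -> : (K - i.-1 * k = 0)%N by lia.
  rewrite mul0r mulr0 sub0r normrN.
  have L0 := rough_lim_ge0 q0 qrec k0; have L1 := rough_lim_le q0 qrec k0.
  have B : 1 <= i.-1%:R * k%:R / K%:R :> R.
    by rewrite ler_pdivlMr// mul1r -natrM ler_nat.
  rewrite normrM (ger0_norm L0) ler0_norm ?subr_le0//.
  apply: (@le_trans _ _ (k%:R^-1 * (i%:R * k%:R / K%:R))).
    apply: ler_pM => //; first by rewrite oppr_ge0 subr_le0.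
    rewrite opprB lerBlDr; apply: (@le_trans _ _ (i%:R * k%:R / K%:R)).
      apply: ler_wpM2r; first by rewrite invr_ge0 ltW.
      by apply: ler_wpM2r; [exact: ltW|rewrite ler_nat leq_pred].
    by rewrite lerDl.
  have -> : k%:R^-1 * (i%:R * k%:R / K%:R) = i%:R / K%:R :> R.
    by field; rewrite !gt_eqF.
  rewrite ler_pdivlMr ?exprn_gt0// mulrAC -[K%:R ^+ 3]/(K%:R * K%:R ^+ 2).
  have -> : i%:R * (K%:R * K%:R ^+ 2) / K%:R = i%:R * K%:R ^+ 2 :> R.
    by field; rewrite gt_eqF.
  apply: (@le_trans _ _ (i%:R * (i%:R * k%:R) ^+ 2)).
    apply: ler_wpM2l => //; rewrite lerXn2r ?nnegrE ?mulr_ge0//.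
    by rewrite -natrM ler_nat (leq_trans large)// leq_mul2r leq_pred orbT.
  rewrite exprMn mulrA -exprS; apply: ler_wpM2r => //.
  rewrite -[leLHS]mul1r; apply: ler_pM => //.
    by rewrite lerDr.
  by rewrite lerXn2r ?nnegrE// ler_nat.
have -> : K%:R^-1 * ((K - i.-1 * k)%:R * q (K - i.-1 * k) k) -
    l k * (1 - i.-1%:R * k%:R / K%:R) =
    (K - i.-1 * k)%:R / K%:R * (q (K - i.-1 * k) k - l k).
  rewrite natrB ?natrM; last exact: ltnW.
  by field; rewrite gt_eqF.
rewrite normrM ger0_norm ?divr_ge0// -[leRHS]mul1r.
apply: ler_pM => //.
  by rewrite ler_pdivrMr// mul1r ler_nat leq_subr.
have := HC K i.-1 k K0 k0.
rewrite (ltn_eqF small) addr0 /shifted (ltnW small) => /le_trans; apply.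
do 2!apply: ler_wpM2r => //; apply: ler_pM => //.
  by rewrite lerDl.
by rewrite lerXn2r ?nnegrE// ler_nat; lia.
Qed.

(* The weights [i.-1 * k] come from the mean of the shifted terms. *)
Definition buchstab_moment I k : R :=
  \sum_(2 <= i < I) i.-1%:R * k%:R * buchstab_coef i k.

(** With [x = 1 / k], the limit is [k sum_(i >= 2) (i - 1) x ^ i / i! = k (x exp x - exp x + 1)]. *)
Lemma buchstab_moment_cvg k : (0 < k)%N ->
  (fun I => buchstab_moment I k) @ \oo -->
  expR k%:R^-1 - k%:R * expR k%:R^-1 + k%:R.
Proof.
move=> k0; have kR : k%:R != 0 :> R by rewrite pnatr_eq0 -lt0n.
pose u n : R := \sum_(i < n) k%:R^-1 ^+ i / i`!%:R.
have u_cvg : u @ \oo --> expR k%:R^-1 by exact: cvg_exp_coeff.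
have cE i : buchstab_coef i k = k%:R^-1 ^+ i / i`!%:R.
  by rewrite /buchstab_coef invfM mulrC exprVn.
have E n : buchstab_moment n.+2 k = u n.+1 - k%:R * u n.+2 + k%:R.
  elim: n => [|n IH].
    rewrite /buchstab_moment big_geq// /u !big_ord_recl !big_ord0 /= !fact0 !expr0 expr1 !divr1.
    by field.
  rewrite /buchstab_moment big_nat_recr//= -/(buchstab_moment n.+2 k) IH.
  rewrite /u ![\sum_(i < n.+3) _]big_ord_recr ![\sum_(i < n.+2) _]big_ord_recr /=.
  rewrite cE; set S := \sum_(i < n.+1) _.
  have -> : k%:R^-1 ^+ n.+1 / (n.+1)`!%:R = n.+2%:R * k%:R * (k%:R^-1 ^+ n.+2 / (n.+2)`!%:R) :> R.
    rewrite [k%:R^-1 ^+ n.+2]exprS.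
    have -> : (n.+2)`!%:R = n.+2%:R * (n.+1)`!%:R :> R by rewrite factS natrM.
    have f0 : (n.+1)`!%:R != 0 :> R by rewrite pnatr_eq0 -lt0n fact_gt0.
    have a0 : n.+2%:R != 0 :> R by rewrite pnatr_eq0.
    move: f0 a0; move: (_ `!%:R) (k%:R^-1 ^+ n.+1) (n.+2%:R) => f p a f0 a0.
    by field; rewrite ?f0 ?kR ?a0.
  by rewrite -(natr1 n.+1); ring.
rewrite -(cvg_shiftn 2).
rewrite (_ : (fun n => _) = (fun n => u n.+1 - k%:R * u n.+2 + k%:R)); last first.
  by apply/funext => n; rewrite addn2 E.
apply: cvgD; last exact: cvg_cst.
apply: cvgB.
  by have H := u_cvg; rewrite -cvg_shiftS in H; exact: H.
apply: cvgM; first exact: cvg_cst.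
by have H := u_cvg; rewrite -(cvg_shiftn 2) in H;
  rewrite (_ : (fun n => u n.+2) = (fun n => u (n + 2)%N))//; apply/funext => n; rewrite addn2.
Qed.

Lemma buchstab_coef_le i k : (1 < i)%N -> (0 < k)%N ->
  0 <= buchstab_coef i k <= (k%:R ^+ 2)^-1 / i`!%:R.
Proof.
move=> i1 k0; have f0 : 0 < i`!%:R :> R by rewrite ltr0n fact_gt0.
rewrite /buchstab_coef; apply/andP; split.
  by rewrite invr_ge0 mulr_ge0 ?exprn_ge0// ltW.
rewrite -invfM [k%:R ^+ 2 * _]mulrC.
rewrite lef_pV2 ?posrE ?mulr_gt0 ?exprn_gt0 ?ltr0n ?fact_gt0//.
by apply: ler_wpM2l; [exact: ltW|rewrite ler_weXn2l ?ler1n].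
Qed.

Lemma sum_nat_eq_le (P : pred nat) m n : {in P &, forall i j, i = j} ->
  \sum_(m <= k < n) (P k)%:R <= 1 :> R.
Proof.
move=> Puniq; elim: n => [|n IH]; first by rewrite big_geq.
have [mn|nm] := leqP m n; last by rewrite big_geq.
rewrite big_nat_recr//=; case Pn : (P n); last by rewrite addr0.
rewrite big1_seq ?add0r// => k; rewrite mem_index_iota => /andP[_ /andP[_ kn]].
case Pk : (P k) => //; have := Puniq _ _ Pk Pn.
by move=> E; rewrite E ltnn in kn.
Qed.

(** In [rough_defectE] replace the shifted value by [l k] and the mean by [l k (1 - (i - 1) k / K)];
    what remains, [l k (i - 1) k / K], gives [buchstab_moment]. The [k ^ 2] in the errors cancels
    against [buchstab_coef], so each of the [N] values of [k] costs [O (1 / N ^ 3)], while the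
    indicator of [i k = N] costs [1 / k ^ 2 = i ^ 2 / N ^ 2] at most once for each [i]. The bounds
    do not depend on the cutoff [I], which finally tends to infinity. *)
Lemma rough_defect_approx : exists2 A : R, 0 <= A & forall N, (0 < N)%N ->
  `|rough_defect N (uphalf N) - (uphalf N)%:R^-1 * (1 - N%:R * l N)| <= A / N%:R ^+ 2.
Proof.
have [C C0 HC] := shifted_dist q0 qrec.
have [D D0 HD] := mean_shifted_dist.
exists ((C + 8 * D + 1) * expR 8).
  by rewrite mulr_ge0 ?expR_ge0 ?addr_ge0 ?mulr_ge0.
move=> N N0; set K := uphalf N.
have NR : 0 < N%:R :> R by rewrite ltr0n.
have K0 : (0 < K)%N by rewrite /K; lia.
have KN : (K <= N)%N by rewrite /K; lia.
have KR : 0 < K%:R :> R by rewrite ltr0n.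
have NK : N%:R <= 2 * K%:R :> R by rewrite -natrM ler_nat /K; lia.
have K3N : (K%:R ^+ 3)^-1 <= 8 / N%:R ^+ 3 :> R.
  rewrite ler_pdivlMr ?exprn_gt0// ler_pdivrMl ?exprn_gt0//.
  have -> : K%:R ^+ 3 * 8 = (2 * K%:R) ^+ 3 :> R by ring.
  by rewrite lerXn2r// nnegrE// mulr_ge0.
pose S I := \sum_(1 <= k < N.+1) l k * buchstab_moment I k.
have bound I : (N < I)%N -> `|rough_defect N K - K%:R^-1 * (1 - S I)| <=
    (C + 8 * D + 1) * expR 8 / N%:R ^+ 2.
  move=> NI; rewrite (rough_defectE K0 KN NI) /S mulrBr mulr1 opprB addrC addrA subrK.
  rewrite mulr_sumr -sumrB; apply: le_trans (ler_norm_sum _ _ _) _.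
  apply: (@le_trans _ _ (\sum_(1 <= k < N.+1) \sum_(2 <= i < I)
     i.+1%:R ^+ 3 / i`!%:R * ((C + 8 * D) / N%:R ^+ 3 + (i * k == N)%N%:R / N%:R ^+ 2))).
    apply: ler_sum_nat => k /andP[k0 _].
    rewrite /buchstab_moment !mulr_sumr -sumrB.
    apply: le_trans (ler_norm_sum _ _ _) _; apply: ler_sum_nat => i /andP[i1 _].
    have kR : 0 < k%:R :> R by rewrite ltr0n.
    have -> : K%:R^-1 * (l k * (i.-1%:R * k%:R * buchstab_coef i k)) -
      (shifted q N (i * k) k - K%:R^-1 * (\sum_(j < K) shifted q j (i * k) k)) * buchstab_coef i k =
      (- (shifted q N (i * k) k - l k) +
       (K%:R^-1 * (\sum_(j < K) shifted q j (i * k) k) - l k * (1 - i.-1%:R * k%:R / K%:R))) *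
      buchstab_coef i k by ring.
    have /andP[c0 c1] := buchstab_coef_le i1 k0.
    rewrite normrM (ger0_norm c0).
    apply: (@le_trans _ _ ((C * i.+1%:R ^+ 3 * k%:R ^+ 2 / N%:R ^+ 3 + (i * k == N)%N%:R +
        8 * D * i.+1%:R ^+ 3 * k%:R ^+ 2 / N%:R ^+ 3) * ((k%:R ^+ 2)^-1 / i`!%:R))).
      apply: ler_pM => //; apply: le_trans (ler_normD _ _) _; apply: lerD.
        by rewrite normrN; exact: HC.
      apply: le_trans (HD K i k K0 i1 k0) _.
      have -> : 8 * D * i.+1%:R ^+ 3 * k%:R ^+ 2 / N%:R ^+ 3 =
        D * i.+1%:R ^+ 3 * k%:R ^+ 2 * (8 / N%:R ^+ 3) by ring.
      by apply: ler_wpM2l K3N; rewrite mulr_ge0 ?exprn_ge0// mulr_ge0 ?exprn_ge0.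
    set e : R := ((i * k)%N == N)%:R.
    have f0 : 0 < i`!%:R :> R by rewrite ltr0n fact_gt0.
    have -> : (C * i.+1%:R ^+ 3 * k%:R ^+ 2 / N%:R ^+ 3 + e +
       8 * D * i.+1%:R ^+ 3 * k%:R ^+ 2 / N%:R ^+ 3) * (k%:R ^- 2 / i`!%:R) =
       (i.+1%:R ^+ 3 * ((C + 8 * D) / N%:R ^+ 3) + e / k%:R ^+ 2) / i`!%:R.
      by field; rewrite ?(gt_eqF f0) ?(gt_eqF kR) ?(gt_eqF NR).
    rewrite [leRHS]mulrAC; apply: ler_wpM2r; first by rewrite invr_ge0 ltW.
    rewrite mulrDr lerD2l /e; case: eqP => [ikN|_]; last by rewrite !mul0r mulr0.
    have -> : N%:R = i%:R * k%:R :> R by rewrite -natrM ikN.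
    have -> : i.+1%:R ^+ 3 * (true%:R / (i%:R * k%:R) ^+ 2) =
      i.+1%:R ^+ 3 / i%:R ^+ 2 * (k%:R ^+ 2)^-1 :> R.
      by rewrite exprMn invfM mul1r; ring.
    apply: ler_wpM2r; first by rewrite invr_ge0 exprn_ge0.
    rewrite ler_pdivlMr ?exprn_gt0 ?ltr0n//; last by lia.
    rewrite mul1r; apply: (@le_trans _ _ (i.+1%:R ^+ 2)).
      by rewrite lerXn2r ?nnegrE// ler_nat.
    by rewrite ler_weXn2l// ler1n.
  rewrite exchange_big_nat /=.
  apply: (@le_trans _ _ (\sum_(2 <= i < I) i.+1%:R ^+ 3 / i`!%:R *
     ((C + 8 * D + 1) / N%:R ^+ 2))).
    apply: ler_sum_nat => i /andP[i1 _].
    rewrite -mulr_sumr; apply: ler_wpM2l; first by rewrite divr_ge0// exprn_ge0.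
    rewrite big_split /= sumr_const_nat subSS subn0 -mulr_suml [leRHS]mulrDl; apply: lerD.
      by rewrite le_eqVlt; apply/orP; left; apply/eqP; rewrite -mulr_natr; field; rewrite gt_eqF.
    apply: ler_wpM2r; first by rewrite invr_ge0 exprn_ge0.
    apply: (@sum_nat_eq_le (fun k => (i * k)%N == N)) => a b /eqP aN /eqP bN.
    by apply/eqP; rewrite -(eqn_pmul2l (m := i)) ?aN ?bN//; lia.
  rewrite -mulr_suml mulrC mulrAC; apply: ler_wpM2r; first by rewrite invr_ge0 exprn_ge0.
  apply: ler_wpM2l; first by rewrite !addr_ge0// mulr_ge0.
  have I2 : (1 < I)%N by lia.
  apply: le_trans (sum_cube_fact_le R I).
  rewrite -(big_mkord xpredT (fun i => i.+1%:R ^+ 3 / i`!%:R)) (@big_cat_nat _ _ _ 2 0 I)//=.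
  by rewrite lerDr sumr_ge0// => i _; rewrite divr_ge0// exprn_ge0.
(* By [rough_lim_step], the [k]-th summand tends to [k l k - (k - 1) l (k - 1)], so the limit
   telescopes. *)
have S_cvg : S @ \oo --> N%:R * l N.
  rewrite /S; elim: (N) => [|n IH].
    rewrite mul0r (_ : (fun I => _) = fun=> 0); first exact: cvg_cst.
    by apply/funext => I; rewrite big_geq.
  rewrite (_ : (fun I => _) = (fun I => \sum_(1 <= k < n.+1) l k * buchstab_moment I k +
     l n.+1 * buchstab_moment I n.+1)); last by apply/funext => I; rewrite big_nat_recr.
  have -> : n.+1%:R * l n.+1 = n%:R * l n + l n.+1 *
     (expR n.+1%:R^-1 - n.+1%:R * expR n.+1%:R^-1 + n.+1%:R).
    by rewrite (rough_lim_step n) -natr1; ring.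
  apply: cvgD => //; apply: cvgM; first exact: cvg_cst.
  exact: buchstab_moment_cvg.
have H : (fun I => `|rough_defect N K - K%:R^-1 * (1 - S I)|) @ \oo -->
    `|rough_defect N K - K%:R^-1 * (1 - N%:R * l N)|.
  apply: cvg_norm; apply: cvgB; first exact: cvg_cst.
  apply: cvgM; first exact: cvg_cst.
  by apply: cvgB => //; exact: cvg_cst.
rewrite -(cvg_lim _ H)//; apply: limr_le; first by apply/cvg_ex; eexists; exact: H.
by exists N.+1 => // I /= NI; exact: bound.
Qed.

End RoughDefect.

(** * The renewal equation *)

Section RoughRenewal.

Variables (R : realType) (q : nat -> nat -> R).
Hypothesis q0 : forall k, q 0 k = 1.
Hypothesis qrec : forall n k, n%:R * q n k = \sum_(i < n - k) q i k.

Variable P : nat -> R.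
Hypothesis renewal : forall N, (0 < N)%N ->
  \sum_(1 <= k < N.+1) P k.-1 * shifted q N k k = 1.

Lemma renewal_wide j N : (0 < j)%N -> (j <= N)%N ->
  \sum_(1 <= k < N.+1) P k.-1 * shifted q j k k = 1.
Proof.
move=> j0 jN; rewrite (@big_cat_nat _ _ _ j.+1)//= renewal// big1_seq ?addr0// => k.
rewrite mem_index_iota => /andP[_ /andP[jk _]].
by rewrite /shifted leqNgt jk mulr0.
Qed.

Lemma renewal_mean K N : (0 < K)%N -> (K <= N)%N ->
  \sum_(1 <= k < N.+1) P k.-1 * q K k = 1 - K%:R^-1.
Proof.
move=> K0 KN; have K1 : K%:R != 0 :> R by rewrite pnatr_eq0 -lt0n.
apply: (mulfI K1); rewrite mulrBr mulfV// mulr1 mulr_sumr.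
under eq_bigr => k _ do rewrite mulrCA (rough_mean qrec) mulr_sumr.
rewrite exchange_big /=.
case: K K0 KN {K1} => // K _ KN.
rewrite big_ord_recl /= big1_seq => [|k]; last first.
  rewrite mem_index_iota => /andP[_ /andP[k1 _]].
  by rewrite /shifted leqn0 gtn_eqF ?mulr0.
rewrite (eq_bigr (fun=> 1)) => [|i _].
  by rewrite sumr_const card_ord -[K.+1%:R]natr1 addrK add0r.
by rewrite -[bump 0 i]/(i.+1); apply: renewal_wide => //; have := ltn_ord i; lia.
Qed.

Lemma renewal_asymptotics (C g D th : R) (N0 : nat) : 0 <= D -> 0 <= th -> th < 1 ->
  C * (1 - g) = 1 ->
  (forall N, (0 < N)%N -> `|N%:R * rough_lim q N - g| <= D / N%:R) ->
  (forall N, (N0 <= N)%N -> \sum_(1 <= k < uphalf N)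
     N%:R ^+ 2 / k%:R ^+ 2 * `|q (uphalf N) k - shifted q N k k| <= th) ->
  exists A : R, forall N, (0 < N)%N -> `|P N.-1 - C / N%:R| <= A / N%:R ^+ 2.
Proof.
move=> D0 th0 th1 Cg HD HT.
have [A A0 HA] := rough_defect_approx q0 qrec.
pose v k : R := P k.-1 - C / k%:R.
pose B0 : R := `|C| * (2 * D + A).
have B00 : 0 <= B0 by rewrite mulr_ge0// addr_ge0// mulr_ge0.
have vE N : (0 < N)%N -> exists2 f : R, `|f| <= B0 / N%:R ^+ 2 &
    v N = f + \sum_(1 <= k < uphalf N) v k * (q (uphalf N) k - shifted q N k k).
  move=> N1; set K := uphalf N.
  have NR : 0 < N%:R :> R by rewrite ltr0n.
  have K0 : (0 < K)%N by rewrite /K; lia.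
  have KN : (K <= N)%N by rewrite /K; lia.
  have KR : 0 < K%:R :> R by rewrite ltr0n.
  exists (K%:R^-1 - C * rough_defect q N K).
    have -> : K%:R^-1 - C * rough_defect q N K =
       K%:R^-1 * (C * (N%:R * rough_lim q N - g)) -
       C * (rough_defect q N K - K%:R^-1 * (1 - N%:R * rough_lim q N)).
      (* The value of [C] enters here: it makes the leading terms [1 / K] and [C (1 - g) / K]
         cancel. *)
      have {1}-> : K%:R^-1 = K%:R^-1 * (C * (1 - g)) by rewrite Cg mulr1.
      by ring.
    apply: le_trans (ler_normB _ _) _; rewrite !normrM.
    have Ki : `|K%:R^-1| <= 2 / N%:R :> R.
      rewrite normfV normr_nat ler_pdivlMr// ler_pdivrMl// mulrC -natrM ler_nat.
      by rewrite /K; lia.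
    apply: (@le_trans _ _ (2 / N%:R * (`|C| * (D / N%:R)) + `|C| * (A / N%:R ^+ 2))).
      apply: lerD; last by apply: ler_wpM2l => //; exact: HA.
      by apply: ler_pM => //; apply: ler_wpM2l => //; exact: HD.
    by rewrite le_eqVlt; apply/orP; left; apply/eqP; rewrite /B0; field; rewrite gt_eqF.
  have E1 : \sum_(1 <= k < N.+1) v k * (shifted q N k k - q K k) =
      K%:R^-1 - C * rough_defect q N K.
    rewrite /rough_defect mulr_sumr.
    under eq_bigr => k _ do rewrite /v mulrBl.
    rewrite sumrB; congr (_ - _); last by apply: eq_bigr => k _; ring.
    under eq_bigr => k _ do rewrite mulrBr.
    by rewrite sumrB renewal_wide// renewal_mean//; ring.
  rewrite -E1 big_nat_recr//= {2}/shifted leqnn subnn q0 (rough_small qrec K0 KN) subr0 mulr1.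
  (* From [K] on both kernels vanish: [q K k = 0] as [K <= k], and [q (N - k) k = 0] as
     [0 < N - k <= k]. *)
  have -> : \sum_(1 <= k < N) v k * (shifted q N k k - q K k) =
      \sum_(1 <= k < K) v k * (shifted q N k k - q K k).
    rewrite (@big_cat_nat _ _ _ K 1 N)//= [X in _ + X]big1_seq ?addr0// => k.
    rewrite mem_index_iota => /andP[_ /andP[Kk kN]].
    rewrite (rough_small qrec K0 Kk) subr0 /shifted ltnW//.
    by rewrite (rough_small qrec) ?mulr0//; rewrite /K in Kk; lia.
  rewrite addrAC -big_split /= big1 ?add0r// => k _.
  by rewrite -mulrDr addrC subrKA subrr mulr0.
(* The first part of [M] gives [B0 + M th <= M], which closes the induction; the second dominates
   the finitely many indices below [N0]. *)
pose M : R := B0 / (1 - th) + \sum_(i < N0) `|v i| * i%:R ^+ 2.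
have M0 : 0 <= M.
  apply: addr_ge0; first by rewrite divr_ge0// subr_ge0 ltW.
  by apply: sumr_ge0 => i _; rewrite mulr_ge0// exprn_ge0.
exists M => N; rewrite -/(v N); elim/ltn_ind: N => N IH N1.
have NR : 0 < N%:R :> R by rewrite ltr0n.
rewrite ler_pdivlMr ?exprn_gt0//.
have [small|large] := ltnP N N0.
  rewrite /M (bigD1 (Ordinal small))//= addrCA lerDl addr_ge0//.
    by rewrite divr_ge0// subr_ge0 ltW.
  by apply: sumr_ge0 => i _; rewrite mulr_ge0// exprn_ge0.
have [f Hf ->] := vE N N1.
apply: (@le_trans _ _ (B0 + M * th)); last first.
  have : B0 / (1 - th) <= M by rewrite /M lerDl sumr_ge0// => i _; rewrite mulr_ge0// exprn_ge0.
  by rewrite ler_pdivrMr ?subr_gt0// mulrBr mulr1 lerBrDr.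
apply: (@le_trans _ _ ((B0 / N%:R ^+ 2 + \sum_(1 <= k < uphalf N)
   M / k%:R ^+ 2 * `|q (uphalf N) k - shifted q N k k|) * N%:R ^+ 2)).
  apply: ler_wpM2r; first by rewrite exprn_ge0.
  apply: le_trans (ler_normD _ _) _; apply: lerD => //.
  apply: le_trans (ler_norm_sum _ _ _) _; apply: ler_sum_nat => k /andP[k0 kK].
  by rewrite normrM; apply: ler_wpM2r => //; apply: IH => //; lia.
rewrite mulrDl divfK ?expf_neq0 ?gt_eqF// lerD2l.
apply: le_trans (ler_wpM2l M0 (HT N large)).
rewrite mulr_suml mulr_sumr; apply: ler_sum_nat => k _.
by rewrite le_eqVlt; apply/orP; left; apply/eqP; ring.
Qed.

End RoughRenewal.

(** * Buchstab bounds on a grid *)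

Section Grid.

Variables (R : realType) (q : nat -> nat -> R).
Hypothesis q0 : forall k, q 0 k = 1.
Hypothesis qrec : forall n k, n%:R * q n k = \sum_(i < n - k) q i k.

(* Mesh [k / G]: the block [j] consists of the [i] with [j k <= G i < (j + 1) k]. *)
Variables (G J : nat) (U L : nat -> R).
Hypothesis G0 : (0 < G)%N.
Hypothesis U_ge0 : forall j, 0 <= U j.
Hypothesis L_ge0 : forall j, 0 <= L j.
Hypothesis U_init : forall j, (j <= G)%N -> 1 <= U j.
Hypothesis L_init : forall j, (j <= G)%N -> L j <= 1.
Hypothesis U_step : forall j, (G <= j < J)%N -> U j + U (j - G).+1 / j%:R <= U j.+1.
Hypothesis L_step : forall j, (G <= j < J)%N -> L j.+1 <= L j + L (j - G)%N / j.+1%:R.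

Local Notation S m k := (\sum_(i < m) q i k).

(** The ceiling of [j k / G], that is, the first index of block [j]. *)
Definition mesh j k := ((j * k + G.-1) %/ G)%N.

Lemma ltn_mesh i j k : (i < mesh j k)%N = (G * i < j * k)%N.
Proof. by rewrite /mesh leq_divRL// mulSn [(i * G)%N]mulnC; apply/idP/idP; lia. Qed.

Lemma mesh_ge j k : (j * k <= G * mesh j k)%N.
Proof. by rewrite leqNgt -ltn_mesh ltnn. Qed.

Lemma mesh_lt j k : (G * mesh j k < j * k + G)%N.
Proof.
have [->|m0] := posnP (mesh j k); first by rewrite muln0 addn_gt0 G0 orbT.
have : (G * (mesh j k).-1 < j * k)%N by rewrite -ltn_mesh; lia.
by rewrite -{2}(prednK m0) mulnS addnC ltn_add2r.
Qed.

Lemma mesh_len_lt j k : (G * (mesh j.+1 k - mesh j k) < k + G)%N.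
Proof. by have := mesh_ge j k; have := mesh_lt j.+1 k; rewrite mulnBr mulSn; lia. Qed.

Lemma mesh_len_gt j k : (k <= G * (mesh j.+1 k - mesh j k).+1)%N.
Proof. by have := mesh_ge j.+1 k; have := mesh_lt j k; rewrite mulnS mulnBr mulSn; lia. Qed.

(** The delay [k] of the recursion is a whole number of blocks, namely [G]. *)
Lemma mesh_sub_le j n k : (j * k <= G * n)%N -> (mesh (j - G) k <= n - k)%N.
Proof. by move=> jn; rewrite leqNgt ltn_mesh -leqNgt mulnBl mulnBr leq_sub2r. Qed.

Lemma leq_mesh_sub j n k : (G <= j)%N -> (k < n)%N -> (G * n < j.+1 * k)%N ->
  (n - k <= mesh (j - G).+1 k)%N.
Proof.
move=> Gj kn nj; have : (G * k <= j * k)%N by rewrite leq_mul2r Gj orbT.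
have nk : (n - k = (n - k).-1.+1)%N by lia.
rewrite nk ltn_mesh mulSn mulnBl; have := mulnS G (n - k).-1; rewrite -nk mulnBr.
by move: nj; rewrite mulSn; lia.
Qed.

Lemma rough_sum_le m n k : (m <= n)%N -> S m k <= S n k.
Proof.
move=> mn; rewrite -!(big_mkord xpredT (q^~ k)) (@big_cat_nat _ _ _ m 0 n)//= lerDl.
by apply: sumr_ge0 => i _; exact: (rough_ge0 q0 qrec).
Qed.

Lemma error_lower (a b d l0 l1 m m0 : R) : a <= b -> 2 * b + m0 <= d ->
  l1 <= l0 + m -> l1 - d <= l0 - b + (m - a - m0).
Proof. by lra. Qed.

Lemma error_upper (a b d u0 u1 m e e' : R) : a <= b -> e <= e' -> 2 * b + e' <= d ->
  u0 + m <= u1 -> u0 + b + (m + a + e) <= u1 + d.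
Proof. by lra. Qed.

Lemma rough_sum_ge1 m k : (0 < m)%N -> 1 <= S m k.
Proof. by move=> m0; have := rough_sum_le k m0; rewrite big_ord1 q0. Qed.

Lemma rough_sum_small m k : (0 < m)%N -> (m <= k.+1)%N -> S m k = 1.
Proof.
case: m => // m _ mk; rewrite big_ord_recl q0 big1 ?addr0// => i _.
by rewrite (rough_small qrec)//= /bump /=; have := ltn_ord i; lia.
Qed.

(** Block [j] has about [k / G] indices [i], where [q i k] is the sum up to [i - k] divided by [i];
    bounding that sum by its values [G] blocks earlier gives an Euler step of the delay equation,
    which is [U_step] or [L_step]. Rounding is collected in [c / k], where [c] depends on the number
    of blocks but not on [k]. Up to block [G] the sum is 1, since [q i k = 0] for [0 < i <= k]. *)
Lemma mesh_sum : forall J', (J' <= J)%N -> exists2 c : R, 0 <= c &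
  forall j k, (0 < j <= J')%N -> (0 < k)%N ->
    L j - c / k%:R <= S (mesh j k) k <= U j + c / k%:R.
Proof.
elim=> [|J' IH] J'J; first by exists 0 => // j k; lia.
have [c c0 Hc] := IH (ltnW J'J).
(* [2 c] carries the earlier errors along, the middle term pays for one index too many in the upper
   bound, and the last one for two missing indices in the lower bound. *)
pose c' := 2 * c + (U (J' - G).+1 + c) * G%:R + 2 * L (J' - G)%N * G%:R.
have GR : 0 < G%:R :> R by rewrite ltr0n.
have c'c : 2 * c <= c'.
  by rewrite /c' -addrA lerDl addr_ge0// !mulr_ge0// ?addr_ge0.
have c'0 : 0 <= c' by apply: le_trans c'c; rewrite mulr_ge0.
exists c' => // j k /andP[j0]; rewrite leq_eqVlt ltnS => /orP[/eqP jE|jJ] k0; last first.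
  have : (0 < j <= J')%N by rewrite j0.
  move=> /(Hc j k) /(_ k0) /andP[lo hi]; apply/andP; split.
    apply: le_trans lo; rewrite lerD2l lerN2 ler_wpM2r ?invr_ge0//.
    by apply: le_trans c'c; rewrite mulr2n mulrDl mul1r lerDl.
  apply: (le_trans hi); rewrite lerD2l ler_wpM2r ?invr_ge0//.
  by apply: le_trans c'c; rewrite mulr2n mulrDl mul1r lerDl.
have kR : 0 < k%:R :> R by rewrite ltr0n.
have ck : 0 <= c' / k%:R by rewrite divr_ge0.
have [jG|GJ'] := leqP j G.
  have -> : S (mesh j k) k = 1.
    apply: rough_sum_small; first by rewrite ltn_mesh muln0 muln_gt0 j0.
    rewrite leqNgt ltn_mesh -leqNgt; apply: (@leq_trans (G * k)); last by rewrite leq_mul2l leqnSn orbT.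
    by rewrite leq_mul2r jG orbT.
  have := U_init jG; have := L_init jG; move: ck; move: (c' / k%:R) => x *.
  by apply/andP; split; lra.
rewrite {j j0}jE in GJ' *; rewrite ltnS in GJ'.
have J'0 : (0 < J')%N by apply: leq_trans GJ'.
have {Hc}Hc j : (0 < j <= J')%N -> L j - c / k%:R <= S (mesh j k) k <= U j + c / k%:R.
  by move=> ?; exact: Hc.
set a := mesh J' k; set b := mesh J'.+1 k.
have ab : (a <= b)%N.
  rewrite leqNgt /a ltn_mesh -leqNgt; apply: leq_trans (mesh_ge _ _).
  by rewrite leq_mul2r leqnSn orbT.
have aG : (J' * k <= G * a)%N by rewrite leqNgt -ltn_mesh ltnn.
have bG : (J'.+1 * k <= G * b)%N by rewrite leqNgt -ltn_mesh ltnn.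
have ka : (k <= a)%N.
  by rewrite -(leq_pmul2l G0); apply: leq_trans aG; rewrite leq_mul2r GJ' orbT.
have SE : S b k = S a k + \sum_(a <= i < b) q i k.
  by rewrite -!(big_mkord xpredT (q^~ k)) (@big_cat_nat _ _ _ a 0 b).
have J'R : 0 < J'%:R :> R by rewrite ltr0n.
have GJ1 : (G <= J' < J)%N by rewrite GJ'.
have Ha : L J' - c / k%:R <= S a k <= U J' + c / k%:R by apply: Hc; rewrite J'0 /=.
apply/andP; split.
  set y := L (J' - G)%N - c / k%:R.
  set x := y * (G%:R / (J'.+1%:R * k%:R)).
  have Jk : 0 < J'.+1%:R * k%:R :> R by rewrite mulr_gt0// ltr0n.
  have xle i : (a < i < b)%N -> x <= q i k.
    move=> /andP[ai ib]; have ki : (k < i)%N by apply: leq_ltn_trans ai.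
    have i0 : 0 < i%:R :> R by rewrite ltr0n; apply: leq_ltn_trans ki.
    have lo : y <= S (i - k) k.
      have [z|nz] := posnP (J' - G).
        have := @rough_sum_ge1 (i - k) k; rewrite subn_gt0 => /(_ ki).
        have := L_init (leq0n G); rewrite /y z; have : 0 <= c / k%:R by rewrite divr_ge0.
        by move: (c / k%:R) => w *; lra.
      have /andP[H _] : L (J' - G)%N - c / k%:R <= S (mesh (J' - G) k) k <= U (J' - G)%N + c / k%:R.
        by apply: Hc; rewrite nz leq_subr.
      apply: le_trans H _; apply: rough_sum_le.
      by apply: mesh_sub_le; apply: leq_trans aG _; rewrite leq_mul2l ltnW ?orbT.
    have [neg|pos] := ltP y 0.
      apply: (@le_trans _ _ 0); last exact: (rough_ge0 q0 qrec).
      by rewrite mulr_le0_ge0 ?ltW// divr_gt0.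
    rewrite -(ler_pM2l i0) qrec; apply: le_trans lo.
    rewrite /x mulrCA -[leRHS]mulr1; apply: ler_wpM2l => //.
    rewrite mulrA ler_pdivrMr// mul1r mulrC -!natrM ler_nat ltnW//.
    by rewrite -ltn_mesh.
  have inc : y / J'.+1%:R - 2 * L (J' - G)%N * G%:R / k%:R <= \sum_(a <= i < b) q i k.
    have LG : 0 <= 2 * L (J' - G)%N * G%:R / k%:R by rewrite divr_ge0// !mulr_ge0.
    have [neg|pos] := ltP y 0.
      apply: (@le_trans _ _ 0); last by apply: sumr_ge0 => i _; exact: (rough_ge0 q0 qrec).
      by rewrite subr_le0; apply: le_trans LG; rewrite mulr_le0_ge0 ?invr_ge0// ltW.
    have x0 : 0 <= x by rewrite mulr_ge0// ltW// divr_gt0.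
    (* The index [a] is dropped because it may equal [k], where [q] vanishes. *)
    apply: (@le_trans _ _ (\sum_(a.+1 <= i < b) q i k)); last first.
      have [aEb|ab'] := leqP b a; first by rewrite !big_geq// ltnW.
      by rewrite [leRHS]big_ltn// lerDr; exact: (rough_ge0 q0 qrec).
    apply: (@le_trans _ _ (\sum_(a.+1 <= i < b) x)); last first.
      by apply: ler_sum_nat => i /andP[ai ib]; apply: xle; rewrite ai.
    rewrite sumr_const_nat -[x *+ _]mulr_natl.
    have cnt : k%:R / G%:R - 2 <= (b - a.+1)%:R :> R.
      rewrite lerBlDr ler_pdivrMr// -natrD -natrM ler_nat.
      apply: leq_trans (mesh_len_gt J' k) _; rewrite mulnC leq_mul2r -/a -/b; apply/orP; right.
      by rewrite subnS; case: (b - a)%N => [|w]; rewrite ?addn2.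
    apply: le_trans (ler_wpM2r x0 cnt); rewrite [leRHS]mulrBl.
    have -> : k%:R / G%:R * x = y / J'.+1%:R.
      have n1 : J'.+1%:R != 0 :> R by rewrite pnatr_eq0.
      rewrite /x; move: n1; move: (J'.+1%:R) => w n1.
      by field; rewrite n1 !gt_eqF.
    rewrite lerD2l lerN2 -!mulrA; apply: ler_wpM2l => //.
    rewrite /x; apply: ler_pM => //.
      by rewrite /y lerBlDr lerDl divr_ge0.
    apply: ler_wpM2l; first exact: ltW.
    by rewrite lef_pV2 ?posrE//; apply: ler_peMl; [exact: ltW|rewrite ler1n].
  rewrite SE; have /andP[Ha1 _] := Ha.
  apply: le_trans (lerD Ha1 inc).
  have := L_step GJ1.
  have H1 : c / k%:R / J'.+1%:R <= c / k%:R.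
    by rewrite ler_pdivrMr ?ltr0n// ler_peMr ?divr_ge0// ler1n.
  have H2 : (2 * c + 2 * L (J' - G)%N * G%:R) / k%:R <= c' / k%:R.
    apply: ler_wpM2r; first by rewrite invr_ge0 ltW.
    by rewrite /c' lerD2r lerDl !mulr_ge0// addr_ge0.
  rewrite /y [(_ - _) / J'.+1%:R]mulrBl.
  move: H2; rewrite [(2 * c + _) / _]mulrDl -[2 * c / _]mulrA => H2 H3.
  exact: error_lower H1 H2 H3.
set y := U (J' - G).+1 + c / k%:R.
have y0 : 0 <= y by rewrite addr_ge0// divr_ge0.
have Jk : 0 < J'%:R * k%:R :> R by rewrite mulr_gt0// ltr0n.
set x := y * (G%:R / (J'%:R * k%:R)).
have x0 : 0 <= x by rewrite mulr_ge0// ltW// divr_gt0.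
have xge i : (a <= i < b)%N -> q i k <= x.
  move=> /andP[ai ib]; have i1 : (0 < i)%N by apply: leq_trans ai; apply: leq_trans ka.
  have i0 : 0 < i%:R :> R by rewrite ltr0n.
  have [ik|ki] := leqP i k; first by rewrite (rough_small qrec).
  rewrite -(ler_pM2l i0) qrec; apply: (@le_trans _ _ y).
    have /andP[_ H] : L (J' - G).+1 - c / k%:R <= S (mesh (J' - G).+1 k) k <= U (J' - G).+1 + c / k%:R.
      by apply: Hc; rewrite /= ltn_subrL G0.
    apply: le_trans H; apply: rough_sum_le.
    by apply: leq_mesh_sub => //; rewrite -ltn_mesh.
  rewrite /x mulrCA -[leLHS]mulr1; apply: ler_wpM2l => //.
  rewrite mulrA ler_pdivlMr// mul1r mulrC -!natrM ler_nat.
  by rewrite mulnC; apply: leq_trans aG _; rewrite mulnC leq_mul2r ai orbT.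
have inc : \sum_(a <= i < b) q i k <= (k%:R / G%:R + 1) * x.
  apply: (@le_trans _ _ (\sum_(a <= i < b) x)); first by apply: ler_sum_nat.
  rewrite sumr_const_nat -[x *+ _]mulr_natl; apply: ler_wpM2r => //.
  have -> : k%:R / G%:R + 1 = (k%:R + G%:R) / G%:R :> R by rewrite mulrDl divff// gt_eqF.
  by rewrite ler_pdivlMr// -natrD -natrM ler_nat mulnC ltnW// mesh_len_lt.
rewrite SE; have /andP[_ Ha2] := Ha.
apply: (le_trans (lerD Ha2 inc)).
have := U_step GJ1.
have H1 : c / k%:R / J'%:R <= c / k%:R.
  by rewrite ler_pdivrMr ?ltr0n// ler_peMr ?divr_ge0// ler1n.
have E1 : (k%:R / G%:R + 1) * x = U (J' - G).+1 / J'%:R + c / k%:R / J'%:R + x.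
  by rewrite /x /y; field; rewrite !gt_eqF.
have H2 : x <= (U (J' - G).+1 + c) * G%:R / k%:R.
  rewrite -[leRHS]mulrA /x; apply: ler_pM => //.
    by rewrite lerD2l ler_pdivrMr// ler_peMr// ler1n.
  apply: ler_wpM2l; first exact: ltW.
  by rewrite lef_pV2 ?posrE//; apply: ler_peMl; [exact: ltW|rewrite ler1n].
have H3 : (2 * c + (U (J' - G).+1 + c) * G%:R) / k%:R <= c' / k%:R.
  apply: ler_wpM2r; first by rewrite invr_ge0 ltW.
  by rewrite /c' lerDl !mulr_ge0.
move: H3; rewrite E1 [(2 * c + _) / _]mulrDl -[2 * c / _]mulrA => H3 H4.
exact: error_upper H1 H2 H3 H4.
Qed.

(** By the recursion [q n k] is the sum up to [n - k] divided by [n], and [n - k] lies [G] blocks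
    below [n]. *)
Lemma grid_bounds : exists2 c : R, 0 <= c & forall j k n, (G <= j < J)%N -> (0 < k)%N ->
  (k < n)%N -> (j * k <= G * n < j.+1 * k)%N ->
  G%:R * L (j - G)%N / j.+1%:R - c / k%:R <= k%:R * q n k <=
  G%:R * U (j - G).+1 / j%:R + c / k%:R.
Proof.
have [c c0 Hc] := mesh_sum (leqnn J).
have GR : 0 < G%:R :> R by rewrite ltr0n.
exists (G%:R * c) => [|j k n /andP[Gj jJ] k0 kn /andP[jn nj]]; first by rewrite mulr_ge0.
have j0 : (0 < j)%N by lia.
have n0 : (0 < n)%N by lia.
have jG1 : (0 < (j - G).+1 <= J)%N by lia.
have jG2 : (j - G <= J)%N by lia.
have nR : 0 < n%:R :> R by rewrite ltr0n.
have kR : 0 < k%:R :> R by rewrite ltr0n.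
have jR : 0 < j%:R :> R by rewrite ltr0n.
have j1R : 0 < j.+1%:R :> R by rewrite ltr0n.
have jn' : j%:R * k%:R <= G%:R * n%:R :> R by rewrite -!natrM ler_nat.
have nj' : G%:R * n%:R <= j.+1%:R * k%:R :> R by rewrite -!natrM ler_nat ltnW.
have ck : 0 <= c / k%:R by rewrite divr_ge0.
have -> : q n k = S (n - k) k / n%:R by rewrite -qrec mulrC mulKf// gt_eqF.
have S0 : 0 <= S (n - k) k by apply: sumr_ge0 => i _; exact: (rough_ge0 q0 qrec).
have lo : L (j - G)%N - c / k%:R <= S (n - k) k.
  have [z|nz] := posnP (j - G).
    have := @rough_sum_ge1 (n - k) k; rewrite subn_gt0 => /(_ kn).
    have := L_init (leq0n G); rewrite z; move: ck.
    by move: (c / k%:R) => w *; lra.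
  have /andP[H _] := Hc (j - G)%N k (introT andP (conj nz jG2)) k0.
  by apply: le_trans H _; apply: rough_sum_le; apply: mesh_sub_le.
have hi : S (n - k) k <= U (j - G).+1 + c / k%:R.
  have /andP[_ H] := Hc (j - G).+1 k jG1 k0.
  by apply: le_trans H; apply: rough_sum_le; apply: leq_mesh_sub.
have E (x : R) : k%:R * (x / n%:R) = x * (k%:R / n%:R) by rewrite mulrCA.
have r0 : 0 <= k%:R / n%:R :> R by rewrite divr_ge0.
have r1 : k%:R / n%:R <= G%:R / j%:R :> R.
  by rewrite ler_pdivrMr// mulrAC ler_pdivlMr// mulrC.
have r2 : G%:R / j.+1%:R <= k%:R / n%:R :> R.
  by rewrite ler_pdivrMr// mulrAC ler_pdivlMr// [leRHS]mulrC.
rewrite E; apply/andP; split; last first.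
  apply: (@le_trans _ _ ((U (j - G).+1 + c / k%:R) * (G%:R / j%:R))).
    by apply: ler_pM.
  rewrite mulrDl [_ * (G%:R / _)]mulrA [U _ * _]mulrC lerD2l.
  rewrite -[leRHS]mulrA [leRHS]mulrC; apply: ler_wpM2l => //.
  by rewrite ler_pdivrMr// ler_peMr ?ler1n// ltW.
have [neg|pos] := ltP (L (j - G)%N - c / k%:R) 0.
  apply: (@le_trans _ _ 0); last by rewrite mulr_ge0.
  rewrite subr_le0 -!mulrA; apply: ler_wpM2l => //; rewrite ler_pdivrMr//.
  have : L (j - G)%N <= c / k%:R by rewrite ltW// -subr_lt0.
  by move=> /le_trans; apply; rewrite ler_peMr// ler1n.
apply: (@le_trans _ _ ((L (j - G)%N - c / k%:R) * (G%:R / j.+1%:R))); last first.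
  by apply: ler_pM => //; rewrite divr_ge0.
rewrite [leRHS]mulrBl [L _ * _]mulrA [L _ * _]mulrC lerD2l lerN2.
rewrite -[leRHS]mulrA [leRHS]mulrC; apply: ler_wpM2l => //.
by rewrite ler_pdivrMr// ler_peMr ?ler1n// ltW.
Qed.

End Grid.

(** * The contraction estimate *)

Section Contraction.

Variables (R : realType) (q : nat -> nat -> R).
Hypothesis q0 : forall k, q 0 k = 1.
Hypothesis qrec : forall n k, n%:R * q n k = \sum_(i < n - k) q i k.

Variables (G : nat) (hi lo d : nat -> R) (c w : R).
Hypothesis G0 : (0 < G)%N.
Hypothesis c0 : 0 <= c.
Hypothesis w0 : 0 <= w.
Hypothesis grid : forall j k n, (G <= j < 9 * G)%N -> (0 < k)%N -> (k < n)%N ->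
  (j * k <= G * n < j.+1 * k)%N ->
  lo j - c / k%:R <= k%:R * q n k <= hi j + c / k%:R.
Hypothesis d01 : forall i, (2 * G <= i < 10 * G)%N -> 0 <= d i <= 1.
Hypothesis d_bound : forall i, (2 * G <= i < 10 * G)%N ->
  forall j, j = i./2 \/ j = uphalf i ->
  hi j - lo (i - G)%N <= d i /\ hi (i - G)%N - lo j <= d i.
Hypothesis w_bound : forall i j, (4 * G <= i < 6 * G)%N -> (4 * G <= j < 6 * G)%N ->
  hi i - lo j <= w.

Local Notation gap N k := (`|q (uphalf N) k - shifted q N k k|).

Lemma grid_dist (u v a b a' b' x k : R) : 0 < k ->
  a - x <= k * u <= b + x -> a' - x <= k * v <= b' + x ->
  forall D, b - a' <= D -> b' - a <= D -> `|u - v| <= (D + 2 * x) / k.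
Proof.
move=> k0 /andP[u1 u2] /andP[v1 v2] D D1 D2.
rewrite ler_pdivlMr// -[X in _ * X](gtr0_norm k0) -normrM mulrC mulrBr ler_norml.
by apply/andP; split; lra.
Qed.

(** Halving [N] halves its block index up to rounding. What [uphalf] adds is at most half a block
    because [G <= k]. *)
Lemma half_block i N k : (0 < G)%N -> (G <= k)%N -> (i * k <= G * N < i.+1 * k)%N ->
  exists2 j, j = i./2 \/ j = uphalf i & (j * k <= G * uphalf N < j.+1 * k)%N.
Proof.
move=> _ Gk /andP[H1 H2].
have H3 : (G * N <= 2 * (G * uphalf N) <= G * N + G)%N.
  rewrite mulnCA -mulnSr !leq_mul2l; apply/andP; split; apply/orP; right; lia.
have [j1|j1] := leqP (i./2.+1 * k) (G * uphalf N).
  exists (uphalf i); first by right.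
  have E : (uphalf i = i./2.+1 \/ uphalf i = i./2)%N by lia.
  have E2 : (2 * uphalf i <= i.+1)%N by lia.
  have E3 : (i.+2 <= 2 * (uphalf i).+1)%N by lia.
  have F2 : (i.+2 * k <= 2 * ((uphalf i).+1 * k))%N by rewrite mulnA leq_mul2r E3 orbT.
  apply/andP; split.
    by case: E => -> //; apply: leq_trans j1; rewrite leq_mul2r leqnSn orbT.
  move: H2 F2 H3; rewrite !mulSn => H2 F2 /andP[_ H3].
  by move: H2 F2 H3 Gk; clear; lia.
exists i./2; first by left.
rewrite j1 andbT.
have E : (2 * i./2 <= i)%N by lia.
have F : (2 * (i./2 * k) <= i * k)%N by rewrite mulnA leq_mul2r E orbT.
by move: F H1 H3; clear; lia.
Qed.

Lemma gap_block i k N : (2 * G <= i < 10 * G)%N -> (G <= k)%N -> (k < uphalf N)%N ->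
  (i * k <= G * N < i.+1 * k)%N -> gap N k <= (d i + 2 * (c / k%:R)) / k%:R.
Proof.
move=> iG Gk kK ikN.
have k0 : (0 < k)%N by lia.
have kN : (k <= N)%N by lia.
have kN' : (k < N - k)%N by lia.
have [j jE jK] := half_block G0 Gk ikN.
have jG : (G <= j < 9 * G)%N by lia.
have iG' : (G <= i - G < 9 * G)%N by lia.
have jN : ((i - G) * k <= G * (N - k) < (i - G).+1 * k)%N.
  move: ikN; rewrite mulSn mulSn mulnBl mulnBr => ikN.
  have : (G * k <= i * k)%N by rewrite leq_mul2r; apply/orP; right; lia.
  by move: ikN; clear; lia.
have [D1 D2] := d_bound iG jE.
rewrite /shifted kN; apply: grid_dist D1 D2; first by rewrite ltr0n.
  exact: grid jK.
exact: grid jN.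
Qed.

Lemma gap_half N k : k = uphalf N -> (N = 2 * k)%N -> (0 < k)%N -> gap N k = 0.
Proof.
move=> <- N2 k0; rewrite /shifted N2 ifT; last by lia.
by rewrite !(rough_small qrec) ?subrr ?normr0//; lia.
Qed.

Local Notation E0 := (11 ^+ 3 * (22 * c * (G%:R + 1) + 1)).

Lemma block_range i k N : (2 * G <= i < 10 * G)%N -> (10 * G <= N)%N ->
  (i * k <= G * N < i.+1 * k)%N -> [/\ (G <= k)%N, (0 < k)%N & (2 * k <= N)%N].
Proof.
move=> /andP[i2 i10] GN /andP[H1 H2].
have H3 : (G * N < G * (10 * k))%N.
  by apply: leq_trans H2 _; rewrite mulnCA mulnA leq_mul2r i10 orbT.
rewrite ltn_pmul2l// in H3.
have H4 : (G * (2 * k) <= G * N)%N.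
  by apply: leq_trans H1; rewrite mulnCA mulnA leq_mul2r i2 orbT.
rewrite leq_pmul2l// in H4.
by move: G0 GN H3 H4; clear; split; lia.
Qed.

Lemma half_eq k N : (uphalf N <= k)%N -> (2 * k <= N)%N -> k = uphalf N /\ N = (2 * k)%N.
Proof. by clear; split; lia. Qed.

(** The [k] for which [N] lies in block [i] satisfy [G N / (i + 1) < k <= G N / i]. There are about
    [G N / (i (i + 1))] of them, and each term is at most [((i + 1) / G) ^ 3 d i / N] up to lower
    order; the product is the main term. *)
Lemma gap_block_sum i N : (2 * G <= i < 10 * G)%N -> (10 * G <= N)%N ->
  \sum_((G * N) %/ i.+1 + 1 <= k < (G * N) %/ i + 1)
    N%:R ^+ 2 / k%:R ^+ 2 * gap N k <=
  d i * i.+1%:R ^+ 2 / (i%:R * G%:R ^+ 2) + E0 / N%:R.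
Proof.
move=> iG GN; have N0 : (0 < N)%N by lia.
have i0 : (0 < i)%N by lia.
have NR : 0 < N%:R :> R by rewrite ltr0n.
have GR : 0 < G%:R :> R by rewrite ltr0n.
have iR : 0 < i%:R :> R by rewrite ltr0n.
have i1R : 0 < i.+1%:R :> R by rewrite ltr0n.
have /andP[d0 d1] := d01 iG.
set X := i.+1%:R / G%:R : R.
have X0 : 0 < X by rewrite divr_gt0.
have X11 : X <= 11.
  rewrite ler_pdivrMr// -natrM ler_nat; lia.
pose B : R := X ^+ 3 * (d i + 22 * c / N%:R) / N%:R.
have B0 : 0 <= B.
  apply: divr_ge0 => //; apply: mulr_ge0; first by rewrite exprn_ge0// ltW.
  by apply: addr_ge0 => //; apply: divr_ge0 => //; apply: mulr_ge0.
have termle k : ((G * N) %/ i.+1 + 1 <= k < (G * N) %/ i + 1)%N ->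
    N%:R ^+ 2 / k%:R ^+ 2 * gap N k <= B.
  rewrite !addn1 => /andP[k1 k2].
  have ikN : (i * k <= G * N < i.+1 * k)%N.
    rewrite ltnS in k2; rewrite leq_divRL// mulnC in k2.
    by rewrite k2 /= [(i.+1 * k)%N]mulnC -ltn_divLR.
  have [Gk k0 k2N] := block_range iG GN ikN.
  have kR : 0 < k%:R :> R by rewrite ltr0n.
  have [kK|Kk] := ltnP k (uphalf N); last first.
    by have [k1' k2'] := half_eq Kk k2N; rewrite gap_half// mulr0.
  apply: le_trans (ler_wpM2l _ (gap_block iG Gk kK ikN)) _.
    by rewrite divr_ge0// exprn_ge0.
  have Nk : N%:R / k%:R <= X.
    rewrite /X ler_pdivrMr// mulrAC ler_pdivlMr// mulrC -!natrM ler_nat ltnW//.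
    by case/andP: ikN.
  have -> : N%:R ^+ 2 / k%:R ^+ 2 * ((d i + 2 * (c / k%:R)) / k%:R) =
    (N%:R / k%:R) ^+ 3 * (d i + 2 * c / N%:R * (N%:R / k%:R)) / N%:R.
    by field; rewrite !gt_eqF.
  apply: ler_wpM2r; first by rewrite invr_ge0 ltW.
  have Nk0 : 0 <= N%:R / k%:R :> R by rewrite divr_ge0.
  have cN : 0 <= 2 * c / N%:R by rewrite divr_ge0// mulr_ge0.
  apply: ler_pM; first by rewrite exprn_ge0.
  - by rewrite addr_ge0// mulr_ge0.
  - by rewrite lerXn2r ?nnegrE// ltW.
  rewrite lerD2l (_ : 22 * c / N%:R = 2 * c / N%:R * 11); last by ring.
  by apply: ler_wpM2l => //; apply: le_trans Nk X11.
apply: (@le_trans _ _ (\sum_((G * N) %/ i.+1 + 1 <= k < (G * N) %/ i + 1) B)).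
  by apply: ler_sum_nat.
rewrite sumr_const_nat subnDr -[B *+ _]mulr_natl.
have cnt : ((G * N) %/ i - (G * N) %/ i.+1)%:R <= G%:R * N%:R / (i%:R * i.+1%:R) + 1 :> R.
  have a1 : ((G * N) %/ i)%:R <= G%:R * N%:R / i%:R :> R.
    by rewrite ler_pdivlMr// -!natrM ler_nat leq_trunc_div.
  have a2 : G%:R * N%:R / i.+1%:R <= ((G * N) %/ i.+1)%:R + 1 :> R.
    by rewrite ler_pdivrMr// natr1 -!natrM ler_nat ltnW// ltn_ceil.
  rewrite natrB; last by rewrite leq_div2l.
  have -> : G%:R * N%:R / (i%:R * i.+1%:R) = G%:R * N%:R / i%:R - G%:R * N%:R / i.+1%:R :> R.
    rewrite -(natr1 i); field; rewrite natr1 !gt_eqF//.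
  by move: a1 a2; move: (_ / i%:R) (_ / i.+1%:R) => a b; lra.
apply: le_trans (ler_wpM2r B0 cnt) _.
have -> : (G%:R * N%:R / (i%:R * i.+1%:R) + 1) * B =
   d i * i.+1%:R ^+ 2 / (i%:R * G%:R ^+ 2) +
   X ^+ 3 * (22 * c * (G%:R / (i%:R * i.+1%:R) + N%:R^-1) + d i) / N%:R.
  rewrite /B /X; move: (gt_eqF i1R); move: (i.+1%:R) => I1 I1n.
  by field; rewrite I1n !gt_eqF.
rewrite lerD2l; apply: ler_wpM2r; first by rewrite invr_ge0 ltW.
have b1 : G%:R / (i%:R * i.+1%:R) <= G%:R :> R.
  rewrite ler_pdivrMr ?mulr_gt0//; apply: ler_peMr; first exact: ltW.
  by rewrite -natrM ler1n muln_gt0 i0.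
have b2 : N%:R^-1 <= 1 :> R by rewrite invf_le1// ler1n.
have b0 : 0 <= G%:R / (i%:R * i.+1%:R) :> R by rewrite divr_ge0// mulr_ge0.
have b3 : 0 <= N%:R^-1 :> R by rewrite invr_ge0.
apply: ler_pM; first by rewrite exprn_ge0// ltW.
- by rewrite addr_ge0// !mulr_ge0// addr_ge0.
- by rewrite lerXn2r ?nnegrE// ltW.
apply: lerD => //; apply: ler_wpM2l; first by rewrite mulr_ge0.
exact: lerD.
Qed.

Lemma gap_middle N : (10 * G <= N)%N ->
  \sum_(N %/ 10 + 1 <= k < N %/ 2 + 1) N%:R ^+ 2 / k%:R ^+ 2 * gap N k <=
  \sum_(2 * G <= i < 10 * G) (d i * i.+1%:R ^+ 2 / (i%:R * G%:R ^+ 2)) +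
  (8 * G)%:R * E0 / N%:R.
Proof.
move=> GN.
have H m : (2 * G <= m <= 10 * G)%N ->
   \sum_((G * N) %/ m + 1 <= k < (G * N) %/ (2 * G) + 1) N%:R ^+ 2 / k%:R ^+ 2 * gap N k <=
   \sum_(2 * G <= i < m) (d i * i.+1%:R ^+ 2 / (i%:R * G%:R ^+ 2) + E0 / N%:R).
  elim: m => [|m IH] /andP[m1 m2]; first by lia.
  move: m1; rewrite leq_eqVlt => /orP[/eqP <-|m1]; first by rewrite !big_geq.
  rewrite ltnS in m1; have m0 : (0 < m)%N by lia.
  rewrite (@big_cat_nat _ _ _ ((G * N) %/ m + 1))/=; first last.
  - by rewrite leq_add2r leq_div2l//; lia.
  - by rewrite leq_add2r leq_div2l.
  rewrite addrC big_nat_recr//=; apply: lerD; first by apply: IH; rewrite m1 ltnW.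
  by apply: gap_block_sum => //; rewrite m1.
have := H (10 * G)%N; rewrite leq_mul2r orbT leqnn => /(_ isT).
rewrite ![((_ * G)%N)]mulnC !divnMl// big_split /= sumr_const_nat => /le_trans; apply.
by rewrite lerD2l -mulnBr -[leLHS]mulr_natl mulrA.
Qed.

Local Notation A0 := (6 ^+ 6 / 5 * 2 ^+ 5).

Lemma tail_range k N : (k <= N %/ 10)%N ->
  [/\ (5 * k <= uphalf N)%N, (k <= N)%N & (uphalf N <= N - k)%N].
Proof. by move=> kN; split; lia. Qed.

Lemma window_range k n : (0 < k)%N -> (5 * k <= n < 6 * k)%N ->
  [/\ (k <= n)%N, (k < n)%N, (k < n - k)%N, (4 * k <= n - k)%N & (n - k < 6 * k)%N].
Proof. by move=> k0 kn; split; lia. Qed.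

Lemma grid_range j : (4 * G <= j < 6 * G)%N -> (G <= j < 9 * G)%N.
Proof. by lia. Qed.

(** For [k <= N / 10] both arguments are at least [5 k], so [rough_tail] applies. Its hypothesis
    follows from [rough_diff_norm]: for [5 k <= n < 6 k], the step at [n] times [n + 1] is a
    difference of two values with arguments in [[4 k, 6 k)], controlled by [w]. In [A0], the factor
    [6 ^ 6 / 5] is that of [rough_tail], and [2 ^ 5] comes from [uphalf N >= N / 2]. *)
Lemma gap_tail N : (0 < N)%N ->
  \sum_(1 <= k < N %/ 10 + 1) N%:R ^+ 2 / k%:R ^+ 2 * gap N k <=
  A0 * w / (5 * 10 ^+ 3) + A0 * c / N%:R.
Proof.
move=> N0; set K := uphalf N.
have NR : 0 < N%:R :> R by rewrite ltr0n.
have KR : 0 < K%:R :> R by rewrite ltr0n /K; lia.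
have NK : N%:R <= 2 * K%:R :> R by rewrite -natrM ler_nat /K; lia.
have A00 : 0 <= A0 :> R 
  by apply: mulr_ge0; [apply: divr_ge0 => //|]; exact: exprn_ge0.
set m := (N %/ 10)%N.
have mN : m%:R <= N%:R / 10 :> R by rewrite ler_pdivlMr// -natrM ler_nat /m; lia.
apply: (@le_trans _ _ (\sum_(1 <= k < m + 1)
   (A0 / N%:R ^+ 3 * (w / 5 * m%:R ^+ 2 + c * m%:R)))).
  apply: ler_sum_nat => k /andP[k0]; rewrite addn1 ltnS => km.
  have kR : 0 < k%:R :> R by rewrite ltr0n.
  have kmR : k%:R <= m%:R :> R by rewrite ler_nat.
  pose D : R := w / 5 + 2 * (c / k%:R) / 5.
  have ck0 : 0 <= c / k%:R by rewrite divr_ge0.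
  have D0 : 0 <= D by rewrite addr_ge0// ?divr_ge0// mulr_ge0.
  have [k5 kN KN] := tail_range km.
  have H n : (5 * k <= n < 6 * k)%N -> `|q n.+1 k - q n k| <= D / k%:R ^+ 2.
    move=> n56; have [kn kn1 kn2 n4 n6'] := window_range k0 n56; have /andP[n5 n6] := n56.
    have n1R : 0 < n.+1%:R :> R by rewrite ltr0n.
    have [i iE] : exists i, i = ((G * n) %/ k)%N by eexists.
    have [j jE] : exists j, j = ((G * (n - k)) %/ k)%N by eexists.
    have ib : (i * k <= G * n < i.+1 * k)%N by rewrite iE leq_trunc_div ltn_ceil.
    have jb : (j * k <= G * (n - k) < j.+1 * k)%N by rewrite jE leq_trunc_div ltn_ceil.
    have i5 : (5 * G <= i < 6 * G)%N.
      rewrite iE leq_divRL// ltn_divLR// -!mulnA ![(_ * (G * _))%N]mulnCA.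
      by rewrite leq_mul2l n5 orbT ltn_pmul2l.
    have j5 : (4 * G <= j < 6 * G)%N.
      rewrite jE leq_divRL// ltn_divLR// -!mulnA ![(_ * (G * _))%N]mulnCA.
      by rewrite leq_mul2l n4 orbT ltn_pmul2l.
    have i5' : (4 * G <= i < 6 * G)%N.
      by case/andP: i5 => a b; rewrite b (leq_trans _ a)// leq_mul2r orbT.
    have W1 := w_bound i5' j5; have W2 := w_bound j5 i5'.
    have i9 := grid_range i5'; have j9 := grid_range j5.
    have := grid_dist kR (grid j9 k0 kn2 jb) (grid i9 k0 kn1 ib) W2 W1.
    rewrite -(rough_diff_norm qrec)// => H.
    have n5R : 5 * k%:R <= n.+1%:R :> R by rewrite -natrM ler_nat leqW.
    rewrite -(ler_pM2l n1R); apply: (le_trans H).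
    have -> : (w + 2 * (c / k%:R)) / k%:R = 5 * k%:R * (D / k%:R ^+ 2).
      by rewrite /D; field; rewrite gt_eqF.
    by apply: ler_wpM2r => //; rewrite divr_ge0// exprn_ge0.
  have T := rough_tail qrec k0 D0 H k5 KN.
  rewrite /shifted kN distrC.
  apply: le_trans (ler_wpM2l _ T) _; first by rewrite divr_ge0// exprn_ge0.
  have K5 : (K%:R ^+ 5)^-1 <= 2 ^+ 5 / N%:R ^+ 5 :> R.
    rewrite ler_pdivlMr ?exprn_gt0// ler_pdivrMl ?exprn_gt0// mulrC -exprMn.
    by rewrite lerXn2r ?nnegrE ?mulr_ge0.
  apply: (@le_trans _ _ (N%:R ^+ 2 / k%:R ^+ 2 * (D * 6 ^+ 6 / 5 * k%:R ^+ 4 * (2 ^+ 5 / N%:R ^+ 5)))).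
    apply: ler_wpM2l; first by rewrite divr_ge0// exprn_ge0.
    by apply: ler_wpM2l K5; rewrite mulr_ge0 ?exprn_ge0// divr_ge0// mulr_ge0// exprn_ge0.
  have -> : N%:R ^+ 2 / k%:R ^+ 2 * (D * 6 ^+ 6 / 5 * k%:R ^+ 4 * (2 ^+ 5 / N%:R ^+ 5)) =
     A0 / N%:R ^+ 3 * (w / 5 * k%:R ^+ 2 + 2 / 5 * c * k%:R).
    by rewrite /D; field; rewrite !gt_eqF.
  apply: ler_wpM2l; first by rewrite divr_ge0// exprn_ge0.
  apply: lerD.
    by apply: ler_wpM2l; rewrite ?divr_ge0// lerXn2r ?nnegrE.
  apply: ler_pM => //; first by rewrite mulr_ge0.
  by apply: ler_piMl => //; lra.
rewrite sumr_const_nat addnK -[X in X <= _]mulr_natl.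
have -> : m%:R * (A0 / N%:R ^+ 3 * (w / 5 * m%:R ^+ 2 + c * m%:R)) =
  A0 / N%:R ^+ 3 * (w / 5 * m%:R ^+ 3 + c * m%:R ^+ 2) by ring.
have -> : A0 * w / (5 * 10 ^+ 3) + A0 * c / N%:R =
  A0 / N%:R ^+ 3 * (w / 5 * (N%:R / 10) ^+ 3 + c * N%:R ^+ 2).
  by field; rewrite gt_eqF.
apply: ler_wpM2l; first by rewrite divr_ge0// exprn_ge0.
have N10 : 0 <= N%:R / 10 :> R by rewrite divr_ge0.
apply: lerD; apply: ler_wpM2l; rewrite ?divr_ge0// lerXn2r ?nnegrE//.
by apply: (le_trans mN); rewrite ler_pdivrMr// ler_peMr ?ltW//; lra.
Qed.

Lemma gap_contraction (th : R) :
  \sum_(2 * G <= i < 10 * G) (d i * i.+1%:R ^+ 2 / (i%:R * G%:R ^+ 2)) +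
    A0 * w / (5 * 10 ^+ 3) < th ->
  exists N0 : nat, forall N, (N0 <= N)%N ->
    \sum_(1 <= k < uphalf N) N%:R ^+ 2 / k%:R ^+ 2 * gap N k <= th.
Proof.
set S := \sum_(2 * G <= i < 10 * G) _; set W := A0 * w / _ => Hth.
pose E : R := (8 * G)%:R * E0 + A0 * c.
have E_ge0 : 0 <= E.
  apply: addr_ge0.
    apply: mulr_ge0 => //; apply: mulr_ge0; first exact: exprn_ge0.
    by apply: addr_ge0 => //; apply: mulr_ge0; [exact: mulr_ge0|exact: addr_ge0].
  by apply: mulr_ge0.
have e0 : 0 < th - (S + W) by rewrite subr_gt0.
exists (maxn (10 * G) (Num.trunc (E / (th - (S + W)))).+1) => N.
rewrite geq_max => /andP[N1 N2].
have N0 : (0 < N)%N by lia.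
have NR : 0 < N%:R :> R by rewrite ltr0n.
have EN : E / N%:R <= th - (S + W).
  rewrite ler_pdivrMr// mulrC -ler_pdivrMr//.
  apply: le_trans (_ : (Num.trunc (E / (th - (S + W)))).+1%:R <= _); last by rewrite ler_nat.
  by rewrite ltW// truncnS_gt.
apply: (@le_trans _ _ (\sum_(1 <= k < N %/ 2 + 1) N%:R ^+ 2 / k%:R ^+ 2 * gap N k)).
  rewrite [leRHS](@big_cat_nat _ _ _ (uphalf N))/=; [|lia|lia].
  by rewrite lerDl; apply: sumr_ge0 => k _; rewrite mulr_ge0// divr_ge0// exprn_ge0.
rewrite (@big_cat_nat _ _ _ (N %/ 10 + 1))/=; [|lia|lia].
apply: le_trans (lerD (gap_tail N0) (gap_middle N1)) _.
have : (8 * G)%:R * E0 / N%:R + A0 * c / N%:R <= th - (S + W) by rewrite -mulrDl.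
by rewrite -/S -/W; move: ((8 * G)%:R * E0 / N%:R) (A0 * c / N%:R) => a b; lra.
Qed.

End Contraction.

(** * Numerical verification on the grid *)

Fixpoint nall (p : N -> bool) (a : N) (n : nat) : bool :=
  if n is n'.+1 then p a && nall p (N.succ a) n' else true.

Fixpoint nsum (f : N -> N) (a : N) (n : nat) : N :=
  if n is n'.+1 then (f a + nsum f (N.succ a) n')%num else 0%num.

Lemma nallP p a n : nall p a n ->
  forall j, (N.to_nat a <= j < N.to_nat a + n)%N -> p (N.of_nat j).
Proof.
elim: n a => [|n IH] a /=; first by move=> _ j; lia.
move=> /andP[pa /IH H] j /andP[aj jn]; have [->|ja] := eqVneq j (N.to_nat a).
  by rewrite N2Nat.id.
by apply: H; lia.
Qed.

Lemma N_of_half i : (N.of_nat i / 2)%num = N.of_nat i./2.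
Proof. by apply: esym; apply: (@N.div_unique _ _ _ (N.of_nat (odd i))); lia. Qed.

(* Fixed-point certificate: an entry [x] stands for [x / sc].  [U] and [L] are
   the bounds of [grid_bounds], [hi] and [lo] the resulting bounds of [k q n k]
   on a block, and [d] the distances needed by [gap_contraction]. *)
Definition grid_check (g sc : N) (U L hi lo d : N -> N) (a b : N) : bool :=
  let G := N.to_nat g in
  [&& nall (fun j => N.leb sc (U j) && N.leb (L j) sc) 0 G.+1,
      nall (fun j => let j' := N.succ j in let i := (j - g)%num in
        [&& N.leb (U j * j + U (N.succ i)) (U j' * j),
            N.leb (L j' * j') (L j * j' + L i),
            N.leb (g * U (N.succ i)) (hi j * j) &
            N.leb (lo j * j') (g * L i)]) g (8 * G),
      nall (fun i => let h := i / 2 in let h' := N.succ i / 2 in let j := (i - g)%num in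
        [&& N.leb (d i) sc,
            N.leb (hi h) (d i + lo j), N.leb (hi j) (d i + lo h),
            N.leb (hi h') (d i + lo j) & N.leb (hi j) (d i + lo h')]) (2 * g) (8 * G),
      N.leb (100 * nsum (fun i => d i * (i + 3)) (2 * g) (8 * G)) (76 * (sc * (g * g))) &
      nall (fun j => N.leb (hi j) a && N.leb b (lo j)) (4 * g) (2 * G) &&
      N.leb (1000 * a) (1000 * b + 3 * sc)]%num.

Section Certificate.

Variables (g sc : N).

(** A missing entry reads as [sc], which stands for 1: this is the initial value of both [U] and [L]
    up to index [g]. *)
Definition read (m : PositiveMap.t N) (j : N) : N :=
  if PositiveMap.find (N.succ_pos j) m is Some x then x else sc.

Fixpoint tabulate (upd : (N -> N) -> N -> N) (n : nat) (j : N) (m : PositiveMap.t N) :=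
  if n is n'.+1 then
    tabulate upd n' (N.succ j) (PositiveMap.add (N.succ_pos j) (upd (read m) j) m)
  else m.

Definition table upd a n := tabulate upd (N.to_nat n) a (PositiveMap.empty N).

(** The tables follow the Euler steps, rounded up for [U] and [hi], down for [L] and [lo]. For
    [sc = 10 ^ 7], the two final numbers stand for an upper bound of [hi] and a lower bound of [lo]
    where [4 <= n / k < 6]; they enclose [exp (- gamma) = 0.5614...] and differ by less than
    0.003. *)
Definition certified : bool := (
  let Um := table (fun U j => U (N.pred j) + U (j - g) / N.pred j + 1) (N.succ g) (8 * g) in
  let Lm := table (fun L j => L (N.pred j) + L (N.pred j - g) / j) (N.succ g) (8 * g) in
  let him := table (fun _ j => g * read Um (N.succ (j - g)) / j + 1) g (8 * g) in
  let lom := table (fun _ j => g * read Lm (j - g) / N.succ j) g (8 * g) in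
  let dm := table (fun _ i => let j := i - g in
    let h := i / 2 in let h' := N.succ i / 2 in
    N.max (N.max (read him h) (read him h') - read lom j)
          (read him j - N.min (read lom h) (read lom h'))) (2 * g) (8 * g) in
  grid_check g sc (read Um) (read Lm) (read him) (read lom) (read dm) 5629345 5600467)%num.

Lemma certified_grid_check : certified ->
  exists (U L hi lo d : N -> N) (a b : N), grid_check g sc U L hi lo d a b.
Proof. by move=> H; do 7!eexists; exact: H. Qed.

End Certificate.

Section GridCheckSound.

Variables (R : realType) (q : nat -> nat -> R).
Hypothesis q0 : forall k, q 0 k = 1.
Hypothesis qrec : forall n k, n%:R * q n k = \sum_(i < n - k) q i k.

Local Notation realN x := ((N.to_nat x)%:R : R).

Lemma realN_le x y : N.leb x y -> realN x <= realN y.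
Proof. by move=> /N.leb_le xy; rewrite ler_nat; lia. Qed.

Lemma realND x y : realN (x + y)%num = realN x + realN y.
Proof. by rewrite N2Nat.inj_add natrD. Qed.

Lemma realNM x y : realN (x * y)%num = realN x * realN y.
Proof. by rewrite N2Nat.inj_mul natrM. Qed.

Lemma realN_nat n : realN (N.of_nat n) = n%:R.
Proof. by rewrite Nat2N.id. Qed.

Lemma realN_nsum f a n :
  realN (nsum f (N.of_nat a) n) = \sum_(a <= i < a + n) realN (f (N.of_nat i)).
Proof.
elim: n a => [|n IH] a; first by rewrite addn0 big_geq.
by rewrite /= realND -Nat2N.inj_succ IH [RHS]big_ltn ?addnS ?ltnS ?leq_addr// addSn.
Qed.

Variables (g sc : N) (Ut Lt hit lot dt : N -> N) (a b : N).
Hypothesis g0 : N.ltb 0 g.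
Hypothesis sc0 : N.ltb 0 sc.
Hypothesis chk : grid_check g sc Ut Lt hit lot dt a b.

Local Notation G := (N.to_nat g).
Local Notation entry f j := (realN (f (N.of_nat j)) / realN sc).

Lemma certificate_scale_gt0 : 0 < realN sc.
Proof. by move/N.ltb_lt: sc0 => sc0'; rewrite ltr0n; lia. Qed.
Let scR := certificate_scale_gt0.

Lemma certificate_mesh_gt0 : (0 < G)%N.
Proof. by move/N.ltb_lt: g0; lia. Qed.
Let G0 := certificate_mesh_gt0.

Lemma entry_ge0 f j : 0 <= entry f j.
Proof. by rewrite divr_ge0. Qed.

Lemma table_init j : (j <= G)%N -> 1 <= entry Ut j /\ entry Lt j <= 1.
Proof.
move=> jG; case/and5P: chk => /nallP /(_ j jG) /andP[/realN_le H1 /realN_le H2] _ _ _ _.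
by rewrite ler_pdivlMr// ler_pdivrMr// mul1r.
Qed.

Lemma block_check j : (G <= j < 9 * G)%N ->
  [/\ realN (Ut (N.of_nat j)) * j%:R + realN (Ut (N.of_nat (j - G).+1)) <=
       realN (Ut (N.of_nat j.+1)) * j%:R,
      realN (Lt (N.of_nat j.+1)) * j.+1%:R <=
       realN (Lt (N.of_nat j)) * j.+1%:R + realN (Lt (N.of_nat (j - G))),
      G%:R * realN (Ut (N.of_nat (j - G).+1)) <= realN (hit (N.of_nat j)) * j%:R &
      realN (lot (N.of_nat j)) * j.+1%:R <= G%:R * realN (Lt (N.of_nat (j - G)))].
Proof.
move=> jG; case/and5P: chk => _ + _ _ _; move=> /nallP /(_ j); rewrite -mulSn => /(_ jG).
have -> : (N.of_nat j - g)%num = N.of_nat (j - G) by lia.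
rewrite -!Nat2N.inj_succ => /and4P[/realN_le H1 /realN_le H2 /realN_le H3 /realN_le H4].
rewrite -?Nat2N.inj_succ !(realND, realNM, realN_nat) in H1 H2 H3 H4.
by [].
Qed.

Lemma entry_le_step x y z n : (0 < n)%N -> realN x * n%:R + realN y <= realN z * n%:R ->
  realN x / realN sc + realN y / realN sc / n%:R <= realN z / realN sc.
Proof.
move=> n0 H; have nR : 0 < n%:R :> R by rewrite ltr0n.
by rewrite [_ / n%:R]mulrAC -mulrDl ler_pM2r ?invr_gt0// -(ler_pM2r nR) mulrDl divfK ?gt_eqF.
Qed.

Lemma entry_ge_step x y z n : (0 < n)%N -> realN z * n%:R <= realN x * n%:R + realN y ->
  realN z / realN sc <= realN x / realN sc + realN y / realN sc / n%:R.
Proof.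
move=> n0 H; have nR : 0 < n%:R :> R by rewrite ltr0n.
by rewrite [_ / n%:R]mulrAC -mulrDl ler_pM2r ?invr_gt0// -(ler_pM2r nR) mulrDl divfK ?gt_eqF.
Qed.

Lemma table_step j : (G <= j < 9 * G)%N ->
  entry Ut j + entry Ut (j - G).+1 / j%:R <= entry Ut j.+1 /\
  entry Lt j.+1 <= entry Lt j + entry Lt (j - G)%N / j.+1%:R.
Proof.
move=> jG; have [H1 H2 _ _] := block_check jG.
have j0 : (0 < j)%N by move: jG G0; clear; lia.
by split; [exact: entry_le_step H1|exact: entry_ge_step H2].
Qed.

Lemma hi_ge j : (G <= j < 9 * G)%N -> G%:R * entry Ut (j - G).+1 / j%:R <= entry hit j.
Proof.
move=> jG; have [_ _ H _] := block_check jG.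
have j0 : (0 < j)%N by move: jG G0; clear; lia.
by rewrite ler_pdivrMr ?ltr0n// mulrA [leRHS]mulrAC ler_pM2r ?invr_gt0.
Qed.

Lemma lo_le j : (G <= j < 9 * G)%N -> entry lot j <= G%:R * entry Lt (j - G)%N / j.+1%:R.
Proof.
move=> jG; have [_ _ _ H] := block_check jG.
by rewrite ler_pdivlMr ?ltr0n// mulrA [leLHS]mulrAC ler_pM2r ?invr_gt0.
Qed.

Lemma entry_sub_le x y z : N.leb x (z + y) ->
  realN x / realN sc - realN y / realN sc <= realN z / realN sc.
Proof. by move=> /realN_le; rewrite realND -mulrBl ler_pM2r ?invr_gt0// lerBlDr. Qed.

Lemma distance_check i : (2 * G <= i < 10 * G)%N -> 0 <= entry dt i <= 1 /\
  forall j, j = i./2 \/ j = uphalf i ->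
    entry hit j - entry lot (i - G)%N <= entry dt i /\
    entry hit (i - G)%N - entry lot j <= entry dt i.
Proof.
move=> iG; case/and5P: chk => _ _ + _ _.
move=> /nallP /(_ i); have -> : N.to_nat (2 * g) = (2 * G)%N by lia.
rewrite -mulnDl => /(_ iG).
have -> : (N.of_nat i - g)%num = N.of_nat (i - G) by lia.
rewrite -Nat2N.inj_succ !N_of_half -uphalfE.
move=> /and5P[/realN_le d1 d2 d3 d4 d5]; split.
  by rewrite entry_ge0/= ler_pdivrMr// mul1r.
by move=> j [] ->; split; exact: entry_sub_le.
Qed.

Lemma osc_bound i j : (4 * G <= i < 6 * G)%N -> (4 * G <= j < 6 * G)%N ->
  entry hit i - entry lot j <= 3 / 10 ^+ 3.
Proof.
move=> iG jG; case/and5P: chk => _ _ _ _ /andP[+ /realN_le].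
move=> /nallP; have -> : N.to_nat (4 * g) = (4 * G)%N by lia.
move=> H; have := H i; have := H j; rewrite -mulnDl.
move=> /(_ jG) /andP[_ /realN_le Hj] /(_ iG) /andP[/realN_le Hi _].
rewrite realND !realNM => ab; rewrite -mulrBl ler_pdivrMr//.
have E : realN 1000 = 10 ^+ 3 :> R by rewrite -natrX; congr (_%:R); lia.
have E3 : realN 3 = 3 :> R by [].
rewrite E E3 in ab.
have p0 : 0 < 10 ^+ 3 :> R by rewrite exprn_gt0.
move: p0 ab Hi Hj; move: (10 ^+ 3) (realN a) (realN b) (realN sc) => p x y s p0 ab Hi Hj.
rewrite mulrAC ler_pdivlMr// mulrBl lerBlDr.
apply: (@le_trans _ _ (p * x)); first by rewrite mulrC ler_pM2l.
by apply: (le_trans ab); rewrite addrC lerD2l mulrC ler_pM2r.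
Qed.

(** [(i + 1) ^ 2 / i <= i + 3] for [i >= 1], which explains the weight [i + 3] in [grid_check] and
    keeps the check free of divisions. *)
Lemma term_bound i : (0 < i)%N -> entry dt i * i.+1%:R ^+ 2 / (i%:R * G%:R ^+ 2) <=
  realN (dt (N.of_nat i)) * (i%:R + 3) / (realN sc * G%:R ^+ 2).
Proof.
move=> i0; have iR : 1 <= i%:R :> R by rewrite ler1n.
have : 0 < G%:R ^+ 2 :> R by rewrite exprn_gt0// ltr0n.
rewrite -natr1; have : 0 <= realN (dt (N.of_nat i)) by [].
move: scR iR; move: (realN sc) (realN (dt (N.of_nat i))) (i%:R) (G%:R ^+ 2) => s t x y s0 x1 t0 y0.
have x0 : 0 < x by lra.
have -> : t / s * (x + 1) ^+ 2 / (x * y) = t * ((x + 1) ^+ 2 / x) / (s * y).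
  by field; rewrite !gt_eqF.
rewrite ler_pM2r ?invr_gt0 ?mulr_gt0//; apply: ler_wpM2l => //.
by rewrite ler_pdivrMr//; nra.
Qed.

Lemma sum_bound :
  \sum_(2 * G <= i < 10 * G) (entry dt i * i.+1%:R ^+ 2 / (i%:R * G%:R ^+ 2)) <=
  76 / 10 ^+ 2.
Proof.
apply: (@le_trans _ _ (\sum_(2 * G <= i < 10 * G)
    realN (dt (N.of_nat i)) * (i%:R + 3) / (realN sc * G%:R ^+ 2))).
  by apply: ler_sum_nat => i iG; apply: term_bound; move: iG G0; clear; lia.
have sG : 0 < realN sc * G%:R ^+ 2 by rewrite mulr_gt0// exprn_gt0// ltr0n.
rewrite -mulr_suml ler_pdivrMr//.
case/and5P: chk => _ _ _ /realN_le + _.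
have -> : (2 * g)%num = N.of_nat (2 * G) by lia.
rewrite !realNM realN_nsum -mulnDl -expr2.
under eq_bigr => i _ do rewrite realNM realND realN_nat.
have -> : realN 3 = 3 :> R by [].
have -> : realN 100 = 10 ^+ 2 :> R by rewrite -natrX; congr (_%:R); lia.
have -> : realN 76 = 76 :> R by [].
have p0 : 0 < 10 ^+ 2 :> R by rewrite exprn_gt0.
by move: p0; move: (10 ^+ 2) => p p0 H; rewrite mulrAC ler_pdivlMr// mulrC.
Qed.

Lemma grid_contraction : exists N0, forall N, (N0 <= N)%N ->
  \sum_(1 <= k < uphalf N) N%:R ^+ 2 / k%:R ^+ 2 * `|q (uphalf N) k - shifted q N k k| <=
  95 / 10 ^+ 2.
Proof.
have Ui j : (j <= G)%N -> 1 <= entry Ut j by move=> /table_init [].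
have Li j : (j <= G)%N -> entry Lt j <= 1 by move=> /table_init [].
have [c c0 Hc] := @grid_bounds R q q0 qrec G (9 * G) (fun j => entry Ut j) (fun j => entry Lt j) G0
  (fun j => entry_ge0 _ _) (fun j => entry_ge0 _ _) Ui Li
  (fun j jG => proj1 (table_step jG)) (fun j jG => proj2 (table_step jG)).
apply: (@gap_contraction R q qrec G (fun j => entry hit j) (fun j => entry lot j)
  (fun i => entry dt i) c (3 / 10 ^+ 3)) => //.
- move=> j k n jG k0 kn /(Hc _ _ _ jG k0 kn) /andP[H1 H2]; apply/andP; split.
    by apply: le_trans H1; rewrite lerD2r lo_le.
  by apply: (le_trans H2); rewrite lerD2r hi_ge.
- by move=> i /distance_check [].
- by move=> i /distance_check [_].
- exact: osc_bound.
(* The tail adds [(6 ^ 6 / 5) 2 ^ 5 (3 / 1000) / 5000 < 0.18] to the 0.76 of the blocks, which stays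
   below 0.95. *)
- by apply: le_lt_trans (lerD sum_bound (lexx _)) _; lra.
Qed.

End GridCheckSound.

(** Decided by computation, with 200 blocks per unit of [n / k] and seven decimals. *)
Lemma grid_certificate : certified 200 (10 ^ 7).
Proof. vm_cast_no_check (erefl true). Qed.

Lemma rough_contraction (R : realType) (q : nat -> nat -> R) : (forall k, q 0 k = 1) ->
  (forall n k, n%:R * q n k = \sum_(i < n - k) q i k) ->
  exists N0, forall N, (N0 <= N)%N ->
  \sum_(1 <= k < uphalf N) N%:R ^+ 2 / k%:R ^+ 2 * `|q (uphalf N) k - shifted q N k k| <=
  95 / 10 ^+ 2.
Proof.
have [U [L [hi [lo [d [a [b chk]]]]]]] := certified_grid_check grid_certificate.
by move=> q0 qrec; exact: (@grid_contraction R q q0 qrec 200 (10 ^ 7) U L hi lo d a b isT isT chk).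
Qed.

(** * Euler's constant *)

Section Gamma.

Variable R : realType.
Implicit Types x y : R.

Lemma ge0_of_derive (f df : R -> R) : f 0 = 0 ->
  (forall x, 0 <= x -> is_derive x 1 f (df x)) -> (forall x, 0 <= x -> 0 <= df x) ->
  forall x, 0 <= x -> 0 <= f x.
Proof.
move=> f0 Df df0 x; rewrite le_eqVlt => /orP[/eqP <-|x0]; first by rewrite f0.
have [z zx] : exists2 c, c \in `]0, x[%R & f x - f 0 = df c * (x - 0).
  apply: MVT => //.
    by move=> z; rewrite in_itv /= => /andP[/ltW z0 _]; exact: Df.
  apply: derivable_within_continuous => z; rewrite in_itv /= => /andP[z0 _].
  by have := Df z z0 => /@ex_derive.
rewrite f0 !subr0 => ->; rewrite mulr_ge0//; last exact: ltW.
by apply: df0; move: zx; rewrite in_itv /= => /andP[/ltW].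
Qed.

Lemma is_derive_ln1p x : 0 <= x -> is_derive x 1 (fun z => ln (1 + z)) (1 + x)^-1.
Proof.
move=> x0; have x1 : 0 < 1 + x by rewrite ltr_wpDr.
have := @is_derive1_comp _ (@ln R) (fun z => 1 + z) x (1 + x)^-1 1 (is_derive1_ln x1).
rewrite mulr1; apply; rewrite -[X in is_derive _ _ _ X]add0r.
exact: is_deriveD.
Qed.

Lemma is_derive_inv1p x : 0 <= x -> is_derive x 1 (fun z => (1 + z)^-1) (- (1 + x) ^- 2).
Proof.
move=> x0; have x1 : 1 + x != 0 by rewrite gt_eqF// ltr_wpDr.
have D : is_derive x 1 (fun z : R => 1 + z) 1.
  by rewrite -[X in is_derive _ _ _ X]add0r; exact: is_deriveD.
by have := is_deriveV x1 D; rewrite /GRing.scale /= mulr1.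
Qed.

Let L (z : R) : R := ln (1 + z).
Let V (z : R) : R := (1 + z)^-1.

(** For [x = 1 / n] the lower bound is a difference of consecutive Euler-Maclaurin corrections plus
    [1 / (n + 1)]. Both sides vanish at 0, and the derivative of their difference simplifies to the
    visibly nonnegative rational function [df]. *)
Lemma ln1p_lower x : 0 <= x ->
  x / 2 * (1 + (1 + x)^-1) - x ^+ 2 / 12 * (1 - (1 + x) ^- 2) +
  x ^+ 4 / 120 * (1 - (1 + x) ^- 4) - x ^+ 6 / 252 * (1 - (1 + x) ^- 6) <= ln (1 + x).
Proof.
move=> x0; rewrite -subr_ge0.
pose f : R -> R := L - (cst (1 / 2) * id * (cst 1 + V) - cst (1 / 12) * id ^+ 2 * (cst 1 - V ^+ 2)
  + cst (1 / 120) * id ^+ 4 * (cst 1 - V ^+ 4) - cst (1 / 252) * id ^+ 6 * (cst 1 - V ^+ 6)).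
pose df z : R := z ^+ 8 * (63 + 126 * z + 98 * z ^+ 2 + 35 * z ^+ 3 + 5 * z ^+ 4) /
   (210 * (1 + z) ^+ 7).
have -> : ln (1 + x) - (x / 2 * (1 + (1 + x)^-1) - x ^+ 2 / 12 * (1 - (1 + x) ^- 2) +
  x ^+ 4 / 120 * (1 - (1 + x) ^- 4) - x ^+ 6 / 252 * (1 - (1 + x) ^- 6)) = f x.
  by rewrite /f !fctE /= /L /V !exprVn; ring.
apply: (@ge0_of_derive f df); last by [].
- by rewrite /f !fctE /= /L addr0 ln1; ring.
- move=> z z0; have D1 := is_derive_ln1p z0; have D2 := is_derive_inv1p z0.
  rewrite /f; apply: is_derive_eq.
  have z1 : 1 + z != 0 by rewrite gt_eqF// ltr_wpDr.
  by rewrite !fctE /= /V /df /GRing.scale /=; field.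
move=> z z0; rewrite /df; apply: divr_ge0.
  by apply: mulr_ge0; rewrite ?exprn_ge0// !addr_ge0// mulr_ge0// exprn_ge0.
by rewrite mulr_ge0// exprn_ge0// addr_ge0.
Qed.

Lemma ln1p_upper x : 0 <= x ->
  ln (1 + x) <= x / 2 * (1 + (1 + x)^-1) - x ^+ 2 / 12 * (1 - (1 + x) ^- 2) +
  x ^+ 4 / 120 * (1 - (1 + x) ^- 4).
Proof.
move=> x0; rewrite -subr_ge0.
pose f : R -> R := cst (1 / 2) * id * (cst 1 + V) - cst (1 / 12) * id ^+ 2 * (cst 1 - V ^+ 2)
  + cst (1 / 120) * id ^+ 4 * (cst 1 - V ^+ 4) - L.
pose df z : R := z ^+ 6 * (5 + 5 * z + z ^+ 2) / (30 * (1 + z) ^+ 5).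
have -> : x / 2 * (1 + (1 + x)^-1) - x ^+ 2 / 12 * (1 - (1 + x) ^- 2) +
  x ^+ 4 / 120 * (1 - (1 + x) ^- 4) - ln (1 + x) = f x.
  by rewrite /f !fctE /= /L /V !exprVn; ring.
apply: (@ge0_of_derive f df); last by [].
- by rewrite /f !fctE /= /L addr0 ln1; ring.
- move=> z z0; have D1 := is_derive_ln1p z0; have D2 := is_derive_inv1p z0.
  have z1 : 1 + z != 0 by rewrite gt_eqF// ltr_wpDr.
  rewrite /f; apply: is_derive_eq.
  by rewrite !fctE /= /V /df /GRing.scale /=; field.
move=> z z0; rewrite /df; apply: divr_ge0.
  by apply: mulr_ge0; rewrite ?exprn_ge0// !addr_ge0// ?mulr_ge0// exprn_ge0.
by rewrite mulr_ge0// exprn_ge0// addr_ge0.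
Qed.

(* Euler-Maclaurin corrections to [H_n - ln n]. *)
Definition em4 (n : nat) : R := (n%:R^-1) / 2 - n%:R ^- 2 / 12 + n%:R ^- 4 / 120.
Definition em6 (n : nat) : R := em4 n - n%:R ^- 6 / 252.

Local Notation H n := (series (@harmonic R) n).

(** Rearranged, [H n - ln n - em6 n] is nonincreasing and [H n - ln n - em4 n] is nondecreasing. *)
Lemma ln_succ_bounds n : (0 < n)%N ->
  em6 n - em6 n.+1 + n.+1%:R^-1 <= ln n.+1%:R - ln n%:R <= em4 n - em4 n.+1 + n.+1%:R^-1.
Proof.
move=> n0; have nR : 0 < n%:R :> R by rewrite ltr0n.
have x0 : 0 <= n%:R^-1 :> R by rewrite invr_ge0 ltW.
have E0 : 1 + n%:R^-1 = n.+1%:R / n%:R :> R.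
  by rewrite -natr1 mulrDl divff ?mul1r// gt_eqF.
have -> : ln n.+1%:R - ln n%:R = ln (1 + n%:R^-1) :> R.
  by rewrite -ln_div ?posrE ?ltr0n// E0.
have := ln1p_lower x0; have := ln1p_upper x0.
have V1 : (1 + n%:R^-1)^-1 = n%:R * n.+1%:R^-1 :> R.
  by rewrite E0 invf_div.
have E1 : n%:R^-1 / 2 * (1 + (1 + n%:R^-1)^-1) = n%:R^-1 / 2 + n.+1%:R^-1 / 2 :> R.
  by rewrite V1 mulrDr mulr1 mulrAC mulrA mulVf ?gt_eqF// mul1r mulrC.
have E j (c : R) : n%:R^-1 ^+ j / c * (1 - (1 + n%:R^-1) ^- j) = n%:R ^- j / c - n.+1%:R ^- j / c :> R.
  rewrite -!exprVn V1 mulrBr mulr1; congr (_ - _).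
  by rewrite mulrAC -exprMn mulKf ?gt_eqF.
rewrite E1 !E /em6 /em4.
move: (n%:R^-1) (n.+1%:R^-1) (n%:R ^- 2) (n.+1%:R ^- 2) (n%:R ^- 4) (n.+1%:R ^- 4) (n%:R ^- 6) (n.+1%:R ^- 6).
by move=> a1 b1 a2 b2 a4 b4 a6 b6 h1 h2; apply/andP; split; lra.
Qed.

Lemma em4_cvg0 : (fun n => em4 n.+1) @ \oo --> 0.
Proof.
have C j (c : R) : (0 < j)%N -> (fun n : nat => n.+1%:R ^- j / c) @ \oo --> 0.
  move=> j0; have h := @cvgn_scale_invX R c^-1 j j0; rewrite -cvg_shiftS in h.
  by under eq_fun do rewrite mulrC; exact: h.
have h : (fun n => n.+1%:R ^- 1 / 2 - n.+1%:R ^- 2 / 12 + n.+1%:R ^- 4 / 120) @ \oo --> 0 - 0 + (0 : R).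
  by apply: cvgD; [apply: cvgB|]; exact: C.
by rewrite subrr addr0 in h.
Qed.

(** The two monotone sequences differ by [n ^ -6 / 252], which tends to 0, so their common limit,
    Euler's constant, lies between them. *)
Lemma gamma_bounds n : (0 < n)%N ->
  H n - ln n%:R - em4 n <= euler_gamma R <= H n - ln n%:R - em6 n.
Proof.
pose w m : R := H m.+1 - ln m.+1%:R - em6 m.+1.
pose v m : R := H m.+1 - ln m.+1%:R - em4 m.+1.
have w_dec : nonincreasing_seq w.
  apply/nonincreasing_seqP => m; have /andP[h _] := @ln_succ_bounds m.+1 isT.
  rewrite /w [H m.+2]seriesSr /=; move: h.
  by move: (H m.+1) (ln _) (ln _) (em6 _) (em6 _) (_^-1) => *; lra.
have v_inc : nondecreasing_seq v.
  apply/nondecreasing_seqP => m; have /andP[_ h] := @ln_succ_bounds m.+1 isT.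
  rewrite /v [H m.+2]seriesSr /=; move: h.
  by move: (H m.+1) (ln _) (ln _) (em4 _) (em4 _) (_^-1) => *; lra.
have vw m : v m <= w m.
  by rewrite /v /w lerD2l lerN2 /em6 gerBl mulr_ge0// invr_ge0 exprn_ge0.
have w_cvg : cvgn w.
  apply: nonincreasing_is_cvgn => //; exists (v 0) => _ [m _ <-].
  by apply: le_trans (vw m); exact: v_inc.
have d0 : (fun m => w m - v m) @ \oo --> 0.
  have h := @cvgn_scale_invX R 252^-1 6 isT; rewrite -cvg_shiftS in h.
  rewrite (_ : (fun m => _) = (fun m : nat => 252^-1 / m.+1%:R ^+ 6))//.
  by apply/funext => m; rewrite /w /v /em6; ring.
have v_lim : v @ \oo --> lim (w @ \oo).
  rewrite -[X in _ --> X]subr0 (_ : v = (fun m => w m - (w m - v m))); last first.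
    by apply/funext => m; ring.
  exact: cvgB.
have gE : euler_gamma R = lim (w @ \oo).
  apply: cvg_lim => //; rewrite -cvg_shiftS.
  have h : (fun m => v m + em4 m.+1) @ \oo --> lim (w @ \oo) + 0.
    by apply: cvgD => //; exact: em4_cvg0.
  rewrite addr0 (_ : (fun m => _) = (fun m => H m.+1 - ln m.+1%:R)) in h; first exact: h.
  by apply/funext => m; rewrite /v subrK.
case: n => // n _; rewrite gE; apply/andP; split.
  rewrite -(cvg_lim _ v_lim)//; apply: (nondecreasing_cvgn_le v_inc).
  by apply/cvg_ex; eexists; exact: v_lim.
exact: (nonincreasing_cvgn_ge w_dec).
Qed.

Lemma harmonic_ln_gamma n : (0 < n)%N ->
  0 <= H n - ln n%:R - euler_gamma R <= n%:R^-1.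
Proof.
move=> n0; have /andP[h1 h2] := gamma_bounds n0.
have a1 : n%:R^-1 <= 1 :> R by rewrite invf_le1 ?ler1n ?ltr0n.
have a0 : 0 <= n%:R^-1 :> R by rewrite invr_ge0.
have X j : (0 < j)%N -> 0 <= (n%:R ^+ j : R)^-1 <= n%:R^-1.
  case: j => // j _; rewrite invr_ge0 exprn_ge0//= -exprVn exprS ler_piMr//.
  by rewrite exprn_ile1.
have /andP[b2 c2] := X 2 isT; have /andP[b4 c4] := X 4 isT; have /andP[b6 c6] := X 6 isT.
move: h1 h2; rewrite /em6 /em4; move: b2 c2 b4 c4 b6 c6.
move: (H n - ln n%:R) (euler_gamma R) (n%:R ^- 2) (n%:R ^- 4) (n%:R ^- 6) (n%:R^-1) a1 a0.
by move=> e g x2 x4 x6 x1 *; apply/andP; split; lra.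
Qed.

End Gamma.

(** * Numerical value of the constant *)

Section Numerics.

Variable R : realType.
Implicit Types t x : R.

(** For [t <= 1 / 2], the partial sum with [m] terms plus [2 t ^ m / m!] is nonincreasing in [m] and
    exceeds partial sums that converge to [expR t]. *)
Lemma expR_taylor_le t n : 0 <= t -> t <= 2^-1 ->
  expR t <= \sum_(i < n) t ^+ i / i`!%:R + 2 * t ^+ n / n`!%:R.
Proof.
move=> t0 t2; pose s (m : nat) : R := \sum_(i < m) t ^+ i / i`!%:R.
have mono m : s m.+1 + 2 * t ^+ m.+1 / m.+1`!%:R <= s m + 2 * t ^+ m / m`!%:R.
  rewrite /s big_ord_recr/= -addrA lerD2l factS natrM invfM exprS.
  have : 0 <= t ^+ m / m`!%:R by rewrite divr_ge0// exprn_ge0.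
  rewrite -[2 * t ^+ m / _]mulrA; move: (t ^+ m) (m`!%:R^-1) => x y xy.
  have -> : 2 * (t * x) * (m.+1%:R^-1 * y) = 2 * (t / m.+1%:R) * (x * y) by ring.
  have : t / m.+1%:R <= 2^-1.
    by apply: le_trans t2; rewrite ler_pdivrMr// ler_peMr// ler1n.
  by move: (x * y) (t / _) xy => u v u0 vu; nra.
have up m : (n <= m)%N -> s m + 2 * t ^+ m / m`!%:R <= s n + 2 * t ^+ n / n`!%:R.
  move=> nm; rewrite -(subnK nm); elim: (m - n)%N => [|j IH]; first by rewrite add0n.
  exact: le_trans (mono _) IH.
rewrite -/(s n) -(cvg_lim (@Rhausdorff R) (@cvg_exp_coeff R t)); apply: limr_le.
  by apply/cvg_ex; exists (expR t); exact: cvg_exp_coeff.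
near=> m; apply: le_trans (up m _); last by near: m; exact: nbhs_infty_ge.
by rewrite lerDl divr_ge0// mulr_ge0// exprn_ge0.
Unshelve. all: by end_near. Qed.

Lemma expR_double x (a b : R) : 0 <= a -> expR x <= a -> a * a <= b -> expR (x + x) <= b.
Proof. by move=> a0 xa; apply: le_trans; rewrite expRD ler_pM// expR_ge0. Qed.

Lemma expR_double_ge x (a b : R) : 0 <= a -> a <= expR x -> b <= a * a -> b <= expR (x + x).
Proof. by move=> a0 xa ab; apply: le_trans ab _; rewrite expRD ler_pM. Qed.

(** Meant for [32 t = ln 8 + gamma]. The Taylor bound is used at the small argument [t] and squared
    five times, with each result rounded up at the twelfth decimal. *)
Lemma expR_up t : 0 <= t -> t <= 83 / 10 ^+ 3 + 20 / 10 ^+ 6 + 537 / 10 ^+ 9 + 714 / 10 ^+ 12 ->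
  expR (32 * t) <= 14 + 248 / 10 ^+ 3 + 579 / 10 ^+ 6 + 348 / 10 ^+ 9 + 197 / 10 ^+ 12.
Proof.
set tu : R := _ + 714 / _ => t0 tt.
have tu0 : 0 <= tu by apply: le_trans tt.
have H0 : expR tu <= 1 + 86 / 10 ^+ 3 + 564 / 10 ^+ 6 + 123 / 10 ^+ 9 + 863 / 10 ^+ 12.
  apply: (le_trans (@expR_taylor_le tu 8 tu0 _)); first by rewrite /tu; lra.
  rewrite !big_ord_recr big_ord0 /= !factS fact0 /tu; lra.
have E (x : R) n : (2 ^+ n.+1) * x = 2 ^+ n * x + 2 ^+ n * x by rewrite exprS; ring.
apply: (@le_trans _ _ (expR (2 ^+ 5 * tu))).
  by rewrite ler_expR; move: t tu tt {t0 tu0 H0}; move=> *; lra.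
rewrite E; apply: (@expR_double _ (3 + 774 / 10 ^+ 3 + 729 / 10 ^+ 6 + 43 / 10 ^+ 9 + 17 / 10 ^+ 12)); [lra| |lra].
rewrite E; apply: (@expR_double _ (1 + 942 / 10 ^+ 3 + 866 / 10 ^+ 6 + 192 / 10 ^+ 9 + 772 / 10 ^+ 12)); [lra| |lra].
rewrite E; apply: (@expR_double _ (1 + 393 / 10 ^+ 3 + 867 / 10 ^+ 6 + 351 / 10 ^+ 9 + 211 / 10 ^+ 12)); [lra| |lra].
rewrite E; apply: (@expR_double _ (1 + 180 / 10 ^+ 3 + 621 / 10 ^+ 6 + 595 / 10 ^+ 9 + 267 / 10 ^+ 12)); [lra| |lra].
rewrite E expr0 mul1r; apply: expR_double H0 _; lra.
Qed.

Lemma expR_lo t : 83 / 10 ^+ 3 + 20 / 10 ^+ 6 + 537 / 10 ^+ 9 <= t ->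
  14 + 248 / 10 ^+ 3 + 579 / 10 ^+ 6 + 19 / 10 ^+ 9 + 666 / 10 ^+ 12 <= expR (32 * t).
Proof.
set tl : R := _ + 537 / _ => tt.
have tl0 : 0 <= tl by rewrite /tl; lra.
have H0 : 1 + 86 / 10 ^+ 3 + 564 / 10 ^+ 6 + 123 / 10 ^+ 9 + 81 / 10 ^+ 12 <= expR tl.
  apply: le_trans (sum_exp_coeff_le 7 tl0).
  rewrite !big_ord_recr big_ord0 /= !factS fact0 /tl; lra.
have E (x : R) n : (2 ^+ n.+1) * x = 2 ^+ n * x + 2 ^+ n * x by rewrite exprS; ring.
apply: (@le_trans _ _ (expR (2 ^+ 5 * tl))); last first.
  by rewrite ler_expR; move: t tl tt {tl0 H0}; move=> *; lra.
rewrite E; apply: (@expR_double_ge _ (3 + 774 / 10 ^+ 3 + 728 / 10 ^+ 6 + 999 / 10 ^+ 9 + 500 / 10 ^+ 12)); [lra| |lra].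
rewrite E; apply: (@expR_double_ge _ (1 + 942 / 10 ^+ 3 + 866 / 10 ^+ 6 + 181 / 10 ^+ 9 + 573 / 10 ^+ 12)); [lra| |lra].
rewrite E; apply: (@expR_double_ge _ (1 + 393 / 10 ^+ 3 + 867 / 10 ^+ 6 + 347 / 10 ^+ 9 + 194 / 10 ^+ 12)); [lra| |lra].
rewrite E; apply: (@expR_double_ge _ (1 + 180 / 10 ^+ 3 + 621 / 10 ^+ 6 + 593 / 10 ^+ 9 + 566 / 10 ^+ 12)); [lra| |lra].
rewrite E expr0 mul1r; apply: expR_double_ge H0 _; lra.
Qed.

Lemma div8_bounds (a b z : R) : 0 < b -> z <= a -> b <= z -> 8 / a <= 8 / z <= 8 / b.
Proof.
move=> b0 za bz; have z0 := lt_le_trans b0 bz; have a0 := lt_le_trans z0 za.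
by rewrite !ler_pM2l// !lef_pV2 ?posrE// za bz.
Qed.

(** Writing [exp (- gamma) = 8 / exp (ln 8 + gamma)] avoids evaluating a logarithm: [gamma_bounds]
    at 8 encloses [ln 8 + gamma] between rationals. *)
Lemma expR_gamma_bounds :
  8 / (14 + 248 / 10 ^+ 3 + 579 / 10 ^+ 6 + 348 / 10 ^+ 9 + 197 / 10 ^+ 12) <=
  expR (- euler_gamma R) <=
  8 / (14 + 248 / 10 ^+ 3 + 579 / 10 ^+ 6 + 19 / 10 ^+ 9 + 666 / 10 ^+ 12).
Proof.
have /andP[g1 g2] := @gamma_bounds R 8 isT.
have H8 : series (@harmonic R) 8%N = 761 / 280.
  rewrite /series /= !big_nat_recr//= big_geq// /harmonic /=; lra.
have e8 : expR (ln 8%:R) = 8 :> R by rewrite lnK// posrE ltr0n.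
rewrite H8 in g1 g2.
have F : expR (- euler_gamma R) = 8 / expR (ln 8%:R + euler_gamma R).
  by rewrite expRD e8 invfM mulVKf// expRN.
have Y : ln 8%:R + euler_gamma R = 32 * ((ln 8%:R + euler_gamma R) / 32) by field.
move: (ln 8%:R) F Y g1 g2 => l -> Y; rewrite /em4 /em6 /em4 => g1 g2.
have t1 : (l + euler_gamma R) / 32 <= 83 / 10 ^+ 3 + 20 / 10 ^+ 6 + 537 / 10 ^+ 9 + 714 / 10 ^+ 12.
  move: g2; move: (euler_gamma R) => e g2; lra.
have t2 : 83 / 10 ^+ 3 + 20 / 10 ^+ 6 + 537 / 10 ^+ 9 <= (l + euler_gamma R) / 32.
  move: g1; move: (euler_gamma R) => e g1; lra.
have t0 : 0 <= (l + euler_gamma R) / 32 by apply: le_trans t2; lra.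
by rewrite Y; apply: div8_bounds (expR_up t0 t1) (expR_lo t2); lra.
Qed.

Lemma cycle_constant_bounds :
  2 + 280 / 10 ^+ 3 + 291 / 10 ^+ 6 <= cycle_constant R < 2 + 280 / 10 ^+ 3 + 292 / 10 ^+ 6.
Proof.
have /andP[] := expR_gamma_bounds; rewrite /cycle_constant.
move: (expR _) => g; rewrite ler_pdivrMr; last lra.
rewrite ler_pdivlMr; last lra.
move=> g1 g2; have g3 : 0 < 1 - g by lra.
apply/andP; split.
  by rewrite -[leRHS]mul1r ler_pdivlMr; [lra|exact: g3].
by rewrite -[ltLHS]mul1r ltr_pdivrMr; [lra|exact: g3].
Qed.

Lemma expR_gamma_lt1 : expR (- euler_gamma R) < 1.
Proof.
have /andP[_ H] := expR_gamma_bounds; apply: le_lt_trans H _.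
by rewrite ltr_pdivrMr; lra.
Qed.

End Numerics.

(** * The proportion of practical permutations *)

Section Proportions.

Variable R : realType.

Definition rough_prop (n k : nat) : R := (count (rough k) n)%:R / n`!%:R.

Definition practical_prop (n : nat) : R := (count practical n)%:R / n`!%:R.

Lemma rough_prop0 k : rough_prop 0 k = 1.
Proof. by rewrite /rough_prop count_rough_ord0 divr1. Qed.

Lemma factR_neq0 n : n`!%:R != 0 :> R.
Proof. by rewrite pnatr_eq0 -lt0n fact_gt0. Qed.

Lemma bin_factR n j : (j <= n)%N -> 'C(n, j)%:R / n`!%:R = (j`!%:R * (n - j)`!%:R)^-1 :> R.
Proof.
move=> jn; have f := factR_neq0; rewrite -(bin_fact jn) !natrM invfM mulrA divff ?mul1r//.
by rewrite pnatr_eq0 -lt0n bin_gt0.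
Qed.

(** After division of [rough_count] by [n!], the factor of a cycle of length [j] is
    ['C(n, j) j! (n - j)! / n! = 1]; with [i = n - j], the condition [k < j] becomes [i < n - k]. *)
Lemma rough_prop_rec n k : n%:R * rough_prop n k = \sum_(i < n - k) rough_prop i k.
Proof.
rewrite /rough_prop mulrA -natrM rough_count natr_sum mulr_suml.
rewrite (big_ord_widen n.+1 (rough_prop^~ k)) ?[RHS]big_mkcond/=; last by rewrite leqW// leq_subr.
rewrite (reindex_inj rev_ord_inj) /=; apply: eq_bigr => -[i /= iN] _.
rewrite subSS count_single.
have -> : (k < n - i)%N = (i < n - k)%N by lia.
case: ltnP => ik; last by rewrite !mul0n !muln0 mul0r.
rewrite mul1n subKn// count_cycle; last by lia.
rewrite [(_ * (_ * _))%N in X in (_ * X)%N]mulnA.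
have -> : ((n - i) * (n - i).-1`! = (n - i)`!)%N.
  have : (0 < n - i)%N by lia.
  by case: (n - i)%N.
rewrite natrM mulrAC bin_factR ?leq_subr// subKn// natrM /rough_prop.
by rewrite mulrC invfM mulrACA mulfV ?mul1r// factR_neq0.
Qed.

(** Here [N = n + 1] and [k = j + 1] for a core covering [j] of [n] points, so that [n - j = N - k]
    and the other cycles are longer than [k]. *)
Lemma practical_prop_renewal N : (0 < N)%N ->
  \sum_(1 <= k < N.+1) practical_prop k.-1 * shifted rough_prop N k k = 1.
Proof.
case: N => // n _; rewrite big_add1 /= big_mkord.
have /(congr1 (fun m => m%:R / n`!%:R : R)) := renewal_count n.
rewrite divff ?factR_neq0// => ->; rewrite natr_sum mulr_suml; apply: eq_bigr => -[i /= iN] _.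
apply: esym; rewrite natrM mulrAC bin_factR// natrM /shifted iN subSS /practical_prop /rough_prop invfM.
by rewrite mulrC mulrACA.
Qed.

(** [N exp (- H_N)] equals [exp (- gamma) exp (- x)] with [0 <= x <= 1 / N]. *)
Lemma rough_lim_gamma N : (0 < N)%N ->
  `|N%:R * rough_lim rough_prop N - expR (- euler_gamma R)| <= expR (- euler_gamma R) / N%:R.
Proof.
move=> N0; have NR : 0 < N%:R :> R by rewrite ltr0n.
rewrite (rough_limE rough_prop0 rough_prop_rec).
have := harmonic_ln_gamma R N0; set x := _ - euler_gamma R => /andP[x0 x1].
have -> : - series harmonic N = - x + - euler_gamma R + - ln N%:R by rewrite /x; ring.
rewrite 2!expRD [expR (- ln _)]expRN lnK ?posrE// mulrC divfK ?gt_eqF//.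
have g0 := expR_gt0 (- euler_gamma R).
have e1 : expR (- x) <= 1 by rewrite -expR0 ler_expR oppr_le0.
have e2 : 1 - x <= expR (- x) by exact: expR_ge1Dx.
rewrite -[X in _ - X]mul1r -mulrBl normrM (gtr0_norm g0) mulrC ler_pM2l// distrC ger0_norm ?subr_ge0//.
by apply: le_trans x1; lra.
Qed.

Lemma practical_prop_asymptotics : exists A : R, forall n,
  `|practical_prop n - cycle_constant R / n.+1%:R| <= A / n.+1%:R ^+ 2.
Proof.
have [N0 HN0] := rough_contraction rough_prop0 rough_prop_rec.
have g1 := expR_gamma_lt1 R.
have [||||A HA] := @renewal_asymptotics R rough_prop rough_prop0 rough_prop_rec practical_prop
  practical_prop_renewal (cycle_constant R) (expR (- euler_gamma R)) (expR (- euler_gamma R))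
  (95 / 10 ^+ 2) N0 _ _ _ _ rough_lim_gamma HN0.
- exact: expR_ge0.
- by rewrite divr_ge0.
- by lra.
- by rewrite mulVf// subr_eq0 gt_eqF.
by exists A => n; exact: (HA n.+1).
Qed.

Lemma proportion_practical n : proportion_all_below R n = practical_prop n.
Proof.
by rewrite /proportion_all_below count_practical card_Sn.
Qed.

End Proportions.

Theorem theorem1p4 (R : realType) :
  (exists E : nat -> R,
     (exists K : R, forall n : nat, (1 <= n)%N -> `|E n| <= K * (1 / n%:R)) /\
     (forall n : nat, (1 <= n)%N ->
        proportion_all_below R n = cycle_constant R / n%:R * (1 + E n))) /\
  2 + 280 / 10 ^+ 3 + 291 / 10 ^+ 6 <= cycle_constant R
    < 2 + 280 / 10 ^+ 3 + 292 / 10 ^+ 6.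
Proof.
have Cbounds := cycle_constant_bounds R; split => //.
have {Cbounds}C0 : 0 < cycle_constant R by case/andP: Cbounds => + _; apply: lt_le_trans; lra.
have [A HA] := practical_prop_asymptotics R; move: (cycle_constant R) C0 HA => C C0 HA.
have A0 : 0 <= A by have := le_trans (normr_ge0 _) (HA 0%N); rewrite expr1n divr1.
exists (fun n => practical_prop R n * n%:R / C - 1); split; last first.
  move=> n n0; rewrite proportion_practical addrC subrK; have nR : 0 < n%:R :> R by rewrite ltr0n.
  by field; rewrite !gt_eqF.
(* [n P n - C = n (P n - C / (n + 1)) - C / (n + 1)]: the first part is at most [A / n] in absolute
   value, and the second is the cost of passing from [C / (n + 1)] to [C / n]. *)
exists ((A + C) / C) => n n0; have nR : 0 < n%:R :> R by rewrite ltr0n.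
have n1R : 0 < n.+1%:R :> R by rewrite ltr0n.
have -> : practical_prop R n * n%:R / C - 1 =
    (n%:R * (practical_prop R n - C / n.+1%:R) - C / n.+1%:R) / C.
  move: (practical_prop R n) => p; rewrite -natr1 in n1R *.
  by field; rewrite !gt_eqF.
rewrite normrM normfV (gtr0_norm C0) mul1r mulrAC ler_pM2r ?invr_gt0//.
apply: (le_trans (ler_normB _ _)); rewrite normrM (gtr0_norm nR).
rewrite (gtr0_norm (divr_gt0 C0 n1R)) mulrDl; apply: lerD.
  apply: (le_trans (ler_wpM2l (ltW nR) (HA n))).
  rewrite mulrCA; apply: ler_wpM2l => //.
  rewrite ler_pdivrMr ?exprn_gt0// mulrC ler_pdivlMr// -expr2.
  by rewrite lerXn2r ?nnegrE// ler_nat.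
by apply: ler_wpM2l; [exact: ltW|rewrite lef_pV2 ?posrE// ler_nat].
Qed.
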